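(* Let $x<L$ and let $b\in\mathcal{C}^1(]-\infty,L])$. Assume that $\lim_{y\to-\infty}p(y)=-\infty$, where $$p(y)=\int_0^ye^{-2\beta(u)}\,du,\qquad\beta(u)=\int_0^ub(w)\,dw.$$ Then the distribution of $\tau_L^\rho$ converges towards the distribution of $\tau_L$ as $\rho\to\infty$. Moreover the Kolmogorov distance satisfies $$d(\tau_L,\tau_L^\rho):=\sup\big\{|F_{\tau_L^\rho}(t)-F_{\tau_L}(t)|:\ t\in\mathbb{R}_+\big\}=\mathcal{O}\Big(-\frac{1}{p(-\rho)}\Big)\quad\text{as }\rho\to\infty,$$ where $F_Y$ denotes the cumulative distribution function of the random variable $Y$.
   Context: $X$ denotes the unique weak solution of $dX_t=b(X_t)\,dt+dB_t$, $X_0=x$, where $B$ is a standard one-dimensional Brownian motion (existence and uniqueness of the weak solution is a standing assumption), $L>x$, and $\tau_L:=\inf\{t\ge0:X_t=L\}$. For a (large) parameter $\rho>0$ the modified drift is $$b_\rho(y)=\begin{cases}b(y)&\text{if }-\rho\le y\le L,\\ b(-\rho)+b'(-\rho)(y+\rho)e^{y+\rho}&\text{if }y<-\rho,\end{cases}$$ $X^\rho$ is the diffusion $dX^\rho_t=b_\rho(X^\rho_t)\,dt+dB_t$, $X^\rho_0=x$ (considered until it reaches $L$), and $\tau_L^\rho:=\inf\{t\ge0:X^\rho_t=L\}$. *)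

(* Defs.v *)
From HB Require Import structures.
From mathcomp Require Import all_boot all_order all_algebra.
From mathcomp Require Import all_classical all_reals all_analysis.

Set Implicit Arguments.
Unset Strict Implicit.
Unset Printing Implicit Defensive.

Import Order.TTheory GRing.Theory Num.Theory.
Import numFieldNormedType.Exports.

Local Open Scope classical_set_scope.
Local Open Scope ring_scope.

(* lets the library's =O_ notation be used at +oo *)
Canonical pinfty_filter_on (R : numFieldType) :=
  FilterType (pinfty_nbhs R) _.

(* Time is a real number; every process below only matters at times t >= 0. *)
Section processes.
Context {R : realType} {d : measure_display} {Omega : measurableType d}.
Implicit Types (F : R -> set_system Omega) (X B : R -> Omega -> R).

Definition filtration F :=
  [/\ forall t : R, 0 <= t -> sigma_algebra setT (F t),
      forall t : R, 0 <= t -> F t `<=` measurable &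
      forall s t : R, 0 <= s -> s <= t -> F s `<=` F t].

Definition adapted F X :=
  forall t : R, 0 <= t -> forall U : set R, measurable U -> F t (X t @^-1` U).

Definition continuous_paths X :=
  forall w, {within `[0, +oo[, continuous (fun t => X t w)}.

(* normal_prob takes the standard deviation, so that B_t - B_s ~ N(0, t - s) *)
Definition brownian_motion (P : probability Omega R) F B :=
  [/\ adapted F B,
      continuous_paths B,
      {ae P, forall w, B 0 w = 0},
      forall s t : R, 0 <= s -> s < t -> forall U : set R, measurable U ->
        P ((B t \- B s) @^-1` U) = normal_prob 0 (Num.sqrt (t - s)) U &
      forall s t : R, 0 <= s -> s < t ->
        forall (A : set Omega) (U : set R), F s A -> measurable U ->
        let incr := (B t \- B s) @^-1` U in
        P (A `&` incr) = (P A * P incr)%E].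

(* X is (the solution component of) a weak solution, up to the random time T,
   of dX_t = a(X_t) dt + dB_t, X_0 = x. The noise being additive, the equation
   is a pathwise integral equation; at t = 0 it gives X_0 = x almost surely.
   After T nothing but continuity and adaptedness is asked of X. *)
Definition weak_solution_until (P : probability Omega R) (a : R -> R) (x : R)
    (T : Omega -> \bar R) X :=
  exists F B,
    [/\ filtration F, brownian_motion P F B, adapted F X, continuous_paths X &
        {ae P, forall w, forall t : R, 0 <= t -> (t%:E <= T w)%E ->
          lebesgue_measure.-integrable `[0, t] (fun s => (a (X s w))%:E) /\
          X t w = x + \int[lebesgue_measure]_(s in `[0, t]) a (X s w) + B t w}].

Definition weak_solution (P : probability Omega R) (a : R -> R) (x : R) X :=
  weak_solution_until P a x (cst +oo%E) X.

(* inf set0 = +oo: the level may never be reached *)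
Definition hitting_time X (l : R) (w : Omega) : \bar R :=
  ereal_inf [set t%:E | t in [set t : R | 0 <= t /\ X t w = l]].

(* The library's cdf is for R-valued variables; hitting times may be +oo. *)
Definition extended_cdf (P : probability Omega R) (T : Omega -> \bar R)
    (t : R) : R :=
  fine (P [set w | (T w <= t%:E)%E]).

End processes.

Definition same_law {R : realType} d (Om : measurableType d)
    d' (Om' : measurableType d') (P : probability Om R) (P' : probability Om' R)
    (X : R -> Om -> R) (X' : R -> Om' -> R) :=
  forall n (t : 'I_n -> R) (U : 'I_n -> set R),
    (forall i, 0 <= t i) -> (forall i, measurable (U i)) ->
    P [set w | forall i, U i (X (t i) w)] =
    P' [set w | forall i, U i (X' (t i) w)].

Definition weak_uniqueness {R : realType} (a : R -> R) (x : R) :=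
  forall (d d' : measure_display)
    (Om : measurableType d) (Om' : measurableType d')
    (P : probability Om R) (P' : probability Om' R) X X',
  weak_solution P a x X -> weak_solution P' a x X' -> same_law P P' X X'.

(* b is C^1 on ]-oo, L]; at the endpoint L the derivative is the left one. *)
Definition C1_upto {R : realType} (b : R -> R) (L : R) :=
  exists2 b' : R -> R,
    forall y : R, y <= L ->
      (b z - b y) / (z - y) @[z --> within `]-oo, L] y^'] --> b' y &
    {within `]-oo, L], continuous b'}.

Definition oriented_integral {R : realType} (u v : R) (f : R -> R) : R :=
  if u <= v then \int[lebesgue_measure]_(w in `[u, v]) f w
  else - \int[lebesgue_measure]_(w in `[v, u]) f w.

Definition beta {R : realType} (b : R -> R) (u : R) : R :=
  oriented_integral 0 u b.

Definition scale_fun {R : realType} (b : R -> R) (y : R) : R :=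
  oriented_integral 0 y (fun u => expR (- 2 * beta b u)).

(* The values above L are irrelevant: only used for diffusions stopped at L. *)
Definition modified_drift {R : realType} (b : R -> R) (rho y : R) : R :=
  if - rho <= y then b y
  else b (- rho) + derive1 b (- rho) * (y + rho) * expR (y + rho).

(* Convergence in distribution, as the parameter tends to +oo, of ]-oo, +oo]-
   valued random variables possibly defined on different probability spaces. *)
Definition cvg_in_distribution {R : realType}
    (d' : R -> measure_display) (Om' : forall r, measurableType (d' r))
    (P' : forall r, probability (Om' r) R) (T' : forall r, Om' r -> \bar R)
    d (Om : measurableType d) (P : probability Om R) (T : Om -> \bar R) :=
  forall t, {for t, continuous (extended_cdf P T)} ->
    extended_cdf (P' r) (@T' r) t @[r --> +oo] --> extended_cdf P T t.

Definition kolmogorov_distance {R : realType}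
    d (Om : measurableType d) (P : probability Om R) (T : Om -> \bar R)
    d' (Om' : measurableType d') (P' : probability Om' R)
    (T' : Om' -> \bar R) : R :=
  sup [set `|extended_cdf P' T' t - extended_cdf P T t| | t in [set t : R | 0 <= t]].

(* Main.v *)
(* The noise being additive, each diffusion solves, path by path, an integral
   equation driven by its Brownian motion, and as long as it stays in (-rho, L) its
   drift is the Lipschitz function b. On every path the Euler scheme stopped on
   leaving (-rho + eps, L - eps) is therefore uniformly close to the diffusion,
   whichever of the two drifts it has elsewhere; and the law of that scheme depends
   on the law of the Brownian increments only. Hence the distribution functions of
   the two hitting times differ by at most the probability that the scheme leaves
   through -rho + eps. Since p is a scale function, p(L) - p is positive and almost
   a martingale along the scheme (up to O(h^(3/2)) per step of length h), which
   bounds that probability by (p(L) - p(x)) / (p(x) - p(-rho + eps)) in the limit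
   h -> 0; then eps -> 0. *)

Require Import Defs.
From HB Require Import structures.
From mathcomp Require Import all_boot all_order all_algebra.
From mathcomp Require Import all_classical all_reals all_analysis.
From mathcomp Require Import measurable_realfun ring lra.

Set Implicit Arguments.
Unset Strict Implicit.
Unset Printing Implicit Defensive.

Import Order.TTheory GRing.Theory Num.Theory.
Import numFieldNormedType.Exports.

Local Open Scope classical_set_scope.
Local Open Scope ring_scope.

(** * Drifts of class C^1 *)

Section drift.
Context {R : realType}.
Implicit Types (b : R -> R) (L : R).

(** Nothing relates the two diffusions path by path: they live on different probability spaces, with
    their own filtrations and noises. What passes from one space to the other is the law of a
    function of finitely many Brownian increments; this is why a scheme is needed, and why it must
    not see the drifts outside the interval. The scheme cannot detect that a path hits L, only that
    it has come within 2 eps of L; continuity of the paths on [0, t] removes this loss as eps -> 0.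
    The comparison is one-sided, but its hypotheses are symmetric in the two diffusions, so
    exchanging them gives the absolute value. The potential p(L) - p is nonnegative, so Markov's
    inequality at the final time bounds the exit probability without any stopping theorem. The
    errors O(h^(3/2)) of the t / h steps add up to O(h^(1/2)). *)

Lemma C1_upto_derive b L : C1_upto b L ->
  exists2 b' : R -> R, (forall y, y < L -> is_derive y 1 b (b' y)) &
    {within `]-oo, L], continuous b'}.
Proof.
move=> [b' db cb']; exists b' => // y yL.
have db0 : h^-1 *: (b (h + y) - b y) @[h --> (0 : R)^'] --> b' y.
  have := db y (ltW yL).
  (* Strictly below [L] the constraint [z <= L] is void for small increments, so the limit is
     two-sided. *)
  have sh : (fun h => h + y) @ (0 : R)^' --> within `]-oo, L] y^'.
    move=> A /=.
    rewrite /within/= => /nbhs_ballP[e /= e0 eA].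
    suff : \forall h \near (0 : R)^', A (h + y) by [].
    near=> h.
    apply: eA => /=.
    - rewrite -ball_normE/= opprD addrCA subrr addr0 normrN; near: h.
      exact: dnbhs0_lt.
    - by rewrite -subr_eq0 addrK; near: h; exact: nbhs_dnbhs_neq.
    - rewrite in_itv/= -lerBrDr (le_trans (ler_norm _))// ltW//.
      near: h; apply: dnbhs0_lt; by rewrite subr_gt0.
  move=> /(cvg_comp _ _ sh); apply: cvg_trans; apply: near_eq_cvg.
  near=> h; rewrite /= addrK mulrC; by [].
have := cvg_lim (@Rhausdorff R) db0.
have eqf : (fun h : R => h^-1 *: (b (h + y) - b y)) =
   (fun h : R => h^-1 *: ((b \o shift y) (h *: (1:R)) - b y)).
  by apply/funext => h /=; rewrite /GRing.scale/= mulr1.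
move=> lb; split; first by rewrite /derivable -eqf; apply/cvg_ex; exists (b' y).
by rewrite /derive -eqf; exact: lb.
Unshelve. all: by end_near. Qed.

Lemma C1_upto_continuous b L : C1_upto b L -> {within `]-oo, L], continuous b}.
Proof.
move=> Cb; have [b' db _] := C1_upto_derive Cb.
apply/continuous_within_itvNycP; split.
  move=> y; rewrite in_itv/= => yL.
  have := db y yL => dy.
  by apply: differentiable_continuous; apply/derivable1_diffP.
case: Cb => {db}b'' db _.
have := db L (lexx L); set q := (X in X --> _ -> _) => dq.
have dq' : (b z - b L) / (z - L) @[z --> L^'-] --> b'' L.
  apply: cvg_trans dq; apply: cvg_app => A.
  rewrite /within/= /at_left /within/=.
  move=> /nbhs_ballP[e /= e0 eA]; apply/nbhs_ballP; exists e => //= z Lz zL.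
  apply: eA => //; first by rewrite lt_eqF.
  by rewrite in_itv/= ltW.
have zL : z - L @[z --> L^'-] --> (0:R).
  rewrite -(subrr L); apply: cvgB; last exact: cvg_cst.
  by apply: cvg_at_left_filter; exact: cvg_id.
(* At the endpoint only the left difference quotient converges; multiplying it by [z - L] recovers
   left continuity. *)
have : ((b z - b L) / (z - L) * (z - L)) + b L @[z --> L^'-] --> b'' L * 0 + b L.
  apply: cvgD; last exact: cvg_cst.
  by apply: cvgM.
rewrite mulr0 add0r.
apply: cvg_trans; apply: near_eq_cvg; near=> z.
by rewrite divfK ?subrK// subr_eq0 lt_eqF.
Unshelve. all: by end_near. Qed.

(** The constant is the maximum of [|b'|] on the compact [[m, L]], where [b'] is continuous up to
    the endpoint. *)
Lemma C1_upto_lipschitz b L (m : R) : C1_upto b L ->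
  exists2 K : R, 0 <= K &
    {in `]m, L[ &, forall u v, `|b u - b v| <= K * `|u - v|}.
Proof.
move=> Cb; have [b' db cb'] := C1_upto_derive Cb.
have [Lm|mL] := leP L m.
  exists 0 => // u v; rewrite in_itv/= => /andP[mu uL].
  by have := lt_trans mu (lt_le_trans uL Lm); rewrite ltxx.
have /EVT_max : m <= L by exact: ltW.
have cn : {within `[m, L], continuous (fun u => `|b' u|)}.
  apply: (@continuous_subspaceW _ _ _ `]-oo, L]).
    by move=> u /=; rewrite !in_itv/= => /andP[].
  by move=> u; apply: continuous_comp; [exact: cb'|exact: norm_continuous].
move=> /(_ _ cn)[c cmL maxc].
exists `|b' c| => // u v.
wlog uv : u v / u <= v => [H um vm|um vm].
  have [uv|/ltW vu] := leP u v; first exact: H.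
  by rewrite distrC (distrC u); apply: H.
rewrite distrC (distrC u).
have ders w : w \in `]u, v[ -> is_derive w 1 b (b' w).
  move: vm; rewrite !in_itv/= => /andP[_ vL] /andP[_ wv].
  by apply: db; exact: lt_trans vL.
have [|w uwv ->] := MVT_segment uv ders.
  apply: (@continuous_subspaceW _ _ _ `]-oo, L]); last exact: C1_upto_continuous.
  move=> w /=; move: vm; rewrite !in_itv/= => /andP[_ vL] /andP[_ wv].
  by rewrite (le_trans wv)// ltW.
rewrite normrM ler_wpM2r//; apply: maxc.
move: um vm uwv; rewrite !in_itv/= => /andP[/ltW mu _] /andP[_ /ltW vL] /andP[uw wv].
by rewrite (le_trans mu)//= (le_trans wv).
Qed.

End drift.

(** * The scale function *)

Lemma integrable_setU d (T : measurableType d) (R : realType)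
    (nu : {measure set T -> \bar R}) (A B : set T) (f : T -> \bar R) :
  measurable A -> measurable B -> [disjoint A & B] ->
  nu.-integrable A f -> nu.-integrable B f -> nu.-integrable (A `|` B) f.
Proof.
move=> mA mB AB /integrableP[mfA fA] /integrableP[mfB fB].
have mf := (measurable_funU f mA mB).2 (conj mfA mfB).
apply/integrableP; split => //.
rewrite ge0_integral_setU//; first exact: lte_add_pinfty.
exact: measurableT_comp.
Qed.

Section scale.
Context {R : realType}.
Notation mu := (@lebesgue_measure R).

(** Removes the case distinction at 0: a difference of integrals from one fixed left end can be
    differentiated in [y] on both sides of 0. *)
Lemma oriented_integral0E (m M y : R) (f : R -> R) :
  m <= 0 -> 0 <= M -> m <= y -> y <= M ->
  mu.-integrable `[m, M] (EFin \o f) ->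
  oriented_integral 0 y f =
  parameterized_integral mu m y f - parameterized_integral mu m 0 f.
Proof.
move=> m0 M0 my yM fi; rewrite /oriented_integral /parameterized_integral.
have intS u v : m <= u -> v <= M -> mu.-integrable `[u, v] (EFin \o f).
  move=> mu' vM; apply: integrableS fi => //.
  by apply: subset_itv; rewrite bnd_simp.
have [y0|y0] := leP 0 y.
  rewrite (@Rintegral_itvB _ _ (BLeft m) (BRight y)) ?bnd_simp//; last exact: intS.
  rewrite Rintegral_itv_obnd_cbnd//.
  by apply: integrableS (intS _ _ m0 yM) => //; exact: subset_itv_oc_cc.
rewrite -[RHS]opprB; congr (- _).
rewrite (@Rintegral_itvB _ _ (BLeft m) (BRight 0)) ?bnd_simp ?(ltW y0)//; last exact: intS.
rewrite Rintegral_itv_obnd_cbnd//.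
by apply: integrableS (intS _ _ my M0) => //; exact: subset_itv_oc_cc.
Qed.

Lemma oriented_integral_derive (m M y : R) (f : R -> R) :
  m <= 0 -> 0 <= M -> m < y -> y < M -> mu.-integrable `[m, M] (EFin \o f) ->
  {for y, continuous f} -> is_derive y 1 (fun z => oriented_integral 0 z f) (f y).
Proof.
move=> m0 M0 my yM fi cf.
have [df f'] := continuous_FTC1_closed yM fi my cf.
apply: (@near_eq_is_derive _ _ _ (fun z => parameterized_integral mu m z f -
   parameterized_integral mu m 0 f)).
- have := @near_in_itvoo _ m M y; rewrite in_itv/= my yM => /(_ isT).
  apply: filterS => z; rewrite in_itv/= => /andP[/ltW mz /ltW zM].
  exact/esym/(@oriented_integral0E m M).
- have dF : is_derive y 1 (fun z => parameterized_integral mu m z f) (f y).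
    by split; [exact: df|exact: (etrans (esym (derive1E _ _)) f')].
  have := is_deriveB dF (is_derive_cst (parameterized_integral mu m 0 f) y 1).
  by rewrite subr0.
Qed.

Lemma oriented_integral_continuous (m M : R) (f : R -> R) :
  m <= 0 -> 0 <= M -> mu.-integrable `[m, M] (EFin \o f) ->
  {within `[m, M], continuous (fun z => oriented_integral 0 z f)}.
Proof.
move=> m0 M0 fi.
have := parameterized_integral_continuous (le_trans m0 M0) fi => cp.
apply: (@subspace_eq_continuous _ _ _ (fun z => parameterized_integral mu m z f -
   parameterized_integral mu m 0 f)).
  move=> z; rewrite inE/= in_itv/= => /andP[mz zM].
  exact/esym/(@oriented_integral0E m M).
by move=> z; apply: cvgB; [exact: cp|exact: cvg_cst].
Qed.

Variables (b : R -> R) (L : R).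
Hypotheses (Cb : C1_upto b L) (b0 : mu.-integrable `[L, 0] (EFin \o b)).

(** The upper end [max L 0] leaves room both for [L] and for the base point 0 of [beta] and of the
    scale function. When [L < 0], the piece [[L, 0]] lies outside the domain of [C1_upto] and is
    covered by [b0]. *)
Let integrable_drift (m : R) : mu.-integrable `[m, Num.max L 0] (EFin \o b).
Proof.
have cint (M : R) : M <= L -> mu.-integrable `[m, M] (EFin \o b).
  move=> ML; apply: continuous_compact_integrable; first exact: segment_compact.
  apply: (@continuous_subspaceW _ _ _ `]-oo, L]); last exact: C1_upto_continuous.
  by move=> z /=; rewrite !in_itv/= => /andP[_ zM]; exact: le_trans ML.
have [L0|L0] := ltP L 0; last exact: cint.
have [mL|Lm] := leP m L; last first.
  by apply: integrableS b0 => //; apply: subset_itv; rewrite bnd_simp// ltW.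
rewrite (@itv_bndbnd_setU _ _ (BLeft m) (BLeft L) (BRight 0)) ?bnd_simp ?(ltW L0)//.
apply: integrable_setU => //; last by apply: integrableS (cint L (lexx L)) => //; exact: subset_itv_co_cc.
apply/disj_setPS => z [/=]; rewrite !in_itv/= => /andP[_ zL] /andP[+ _].
by rewrite leNgt zL.
Qed.

Let beta_continuous (m : R) : m <= 0 ->
  {within `[m, Num.max L 0], continuous (beta b)}.
Proof.
move=> m0; apply: oriented_integral_continuous => //.
by rewrite le_max lexx orbT.
Qed.

Let integrable_expbeta (m : R) : m <= 0 ->
  mu.-integrable `[m, Num.max L 0] (EFin \o (fun u => expR (- 2 * beta b u))).
Proof.
move=> m0; have cb := beta_continuous m0.
have ce : {within `[m, Num.max L 0], continuous (fun u => expR (- 2 * beta b u))}.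
  move=> z; apply: continuous_comp; last exact: continuous_expR.
  by apply: continuous_comp; [exact: cb|exact: mulrl_continuous].
by apply: continuous_compact_integrable; first exact: segment_compact.
Qed.
Let maxL0 : 0 <= Num.max L 0. Proof. by rewrite le_max lexx orbT. Qed.

(** Provides a left end that puts [z] in the interior of an interval containing 0, as
    differentiating the integral requires. *)
Let minm (z : R) : Num.min z 0 - 1 <= 0 /\ Num.min z 0 - 1 < z.
Proof.
have : Num.min z 0 <= z by rewrite ge_min lexx.
have : Num.min z 0 <= 0 by rewrite ge_min lexx orbT.
by lra.
Qed.

Lemma beta_derive z : z < L -> is_derive z 1 (beta b) (b z).
Proof.
move=> zL; have [m0 mz] := minm z.
apply: (oriented_integral_derive m0 maxL0 mz).
- by rewrite lt_max zL.
- exact: integrable_drift.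
- have /continuous_within_itvNycP[cb _] := C1_upto_continuous Cb.
  by apply: cb; rewrite in_itv.
Qed.

Lemma scale_fun_derive z : z < L ->
  is_derive z 1 (scale_fun b) (expR (- 2 * beta b z)).
Proof.
move=> zL; have [m0 mz] := minm z.
apply: (@oriented_integral_derive _ _ _ (fun u => expR (- 2 * beta b u)) m0 maxL0 mz).
- by rewrite lt_max zL.
- exact: integrable_expbeta.
- have bz : {for z, continuous (beta b)}.
    by apply: differentiable_continuous; apply/derivable1_diffP; have := beta_derive zL.
  apply: continuous_comp; last exact: continuous_expR.
  by apply: continuous_comp; [exact: bz|exact: mulrl_continuous].
Qed.

(** In terms of the scale function this is p'' = -2 b p': the generator b f' + f''/2 vanishes at f =
    p. *)
Lemma expbeta_derive z : z < L ->
  is_derive z 1 (fun u => expR (- 2 * beta b u))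
    (- 2 * b z * expR (- 2 * beta b z)).
Proof.
move=> zL; have db := beta_derive zL.
apply: is_derive_eq.
by rewrite /GRing.scale/=; ring.
Qed.

(** The end [v = L] is included: the derivative is used in the interior only, and continuity up to
    [L] comes from p being an integral. *)
Lemma scale_fun_lt u v : u < v -> v <= L -> scale_fun b u < scale_fun b v.
Proof.
move=> uv vL; have [m0 mu'] := minm u; set m := Num.min u 0 - 1 in m0 mu'.
have [| |w _ E] := @MVT _ (scale_fun b) (fun z => expR (- 2 * beta b z)) _ _ uv.
- by move=> w; rewrite in_itv/= => /andP[_ wv]; apply: scale_fun_derive; exact: lt_le_trans vL.
- apply: (@continuous_subspaceW _ _ _ `[m, Num.max L 0]).
    move=> w /=; rewrite !in_itv/= => /andP[uw wv].
    by rewrite (le_trans _ uw) ?(ltW mu')//= le_max (le_trans wv vL).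
  by apply: oriented_integral_continuous => //; exact: integrable_expbeta.
- by rewrite -subr_gt0 E mulr_gt0 ?expR_gt0// subr_gt0.
Qed.

End scale.

(** * Gaussian moments *)

Section gaussian.
Context {R : realType}.
Notation mu := (@lebesgue_measure R).

Lemma cvgy0_le (G : R -> R) (C : R) : (forall y, 1 <= y -> `|G y| <= C / y) ->
  G y @[y --> +oo] --> (0 : R).
Proof.
move=> GC; apply/norm_cvg0P; apply: (@squeeze_cvgr _ _ _ _ (fun=> 0) (fun y => C / y)).
- near=> y; rewrite normr_ge0 GC//; near: y; exact: nbhs_pinfty_ge.
- exact: cvg_cst.
- rewrite -(mulr0 C); apply: cvgM; first exact: cvg_cst.
  apply/(@gtr0_cvgV0 _ _ _ _ id); last exact: cvg_id.
  exact: nbhs_pinfty_gt.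
Unshelve. all: by end_near. Qed.

Variable s : R.
Hypothesis s0 : 0 < s.

Let e (y : R) := normal_fun 0 s y.

Let eE y : e y = expR (- (y ^+ 2 / (s ^+ 2 *+ 2))).
Proof. by rewrite /e /normal_fun subr0 mulNr. Qed.

Let e_ge0 y : 0 <= e y. Proof. exact: normal_fun_ge0. Qed.

Let e_continuous : continuous e.
Proof.
have -> : e = fun y => expR (- (y ^+ 2 / (s ^+ 2 *+ 2))) by apply/funext => y; exact: eE.
move=> y; apply: continuous_comp; last exact: continuous_expR.
apply: cvgN; apply: cvgM; last exact: cvg_cst.
exact: exprn_continuous.
Qed.

Let e_derive (y : R) : is_derive y (1 : R) (e : R -> R) (- (y / s ^+ 2) * e y).
Proof.
have -> : e = fun y => expR (- (y ^+ 2 / (s ^+ 2 *+ 2))) by apply/funext => z; exact: eE.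
apply: is_derive_eq.
by rewrite /GRing.scale/=; field; rewrite gt_eqF.
Qed.

(** Fourth-power decay suffices for the primitives below to vanish at infinity. The exponent is
    [2 v] with [v = y^2 / (4 s^2)], and [v <= exp v] is used twice. *)
Let e_le y : 1 <= y -> e y <= 64 * s ^+ 4 / y ^+ 4.
Proof.
move=> y1; have y0 : 0 < y by lra.
rewrite eE -[leRHS]invrK expRN lef_pV2 ?posrE ?expR_gt0 ?invr_gt0 ?divr_gt0 ?mulr_gt0 ?exprn_gt0//.
have -> : y ^+ 2 / (s ^+ 2 *+ 2) = y ^+ 2 / (4 * s ^+ 2) + y ^+ 2 / (4 * s ^+ 2).
  by field; rewrite gt_eqF.
set v := y ^+ 2 / (4 * s ^+ 2); rewrite expRD.
have v0 : 0 <= v by rewrite divr_ge0 ?mulr_ge0 ?exprn_ge0 ?ltW.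
have -> : (64 * s ^+ 4 / y ^+ 4)^-1 = v * v / 4.
  by rewrite /v; field; rewrite !gt_eqF.
have : v <= expR v by rewrite (le_trans _ (expR_ge1Dx v))// lerDr.
move=> vv; have : v * v <= expR v * expR v by exact: ler_pM.
have := mulr_ge0 v0 v0; lra.
Qed.

(** The primitive of [y^3 e(y)] that vanishes at infinity, obtained by parts; its value at 0 gives
    the half-line third moment. *)
Let F3 y := - (s ^+ 2 * y ^+ 2 + 2 * s ^+ 4) * e y.

Let integral_y3 : (\int[mu]_(y in `[0%R, +oo[) (y ^+ 3 * e y)%:E = (2 * s ^+ 4)%:E)%E.
Proof.
have dF3 (y : R) : is_derive y 1 F3 (y ^+ 3 * e y).
  have de := e_derive y; apply: is_derive_eq.
  by rewrite /GRing.scale/=; field; rewrite gt_eqF.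
have cF3 : continuous F3.
  by move=> y; apply: differentiable_continuous; apply/derivable1_diffP; have := dF3 y.
rewrite (@ge0_continuous_FTC2y _ _ F3 0 0).
- by rewrite -EFinB; congr EFin; rewrite /F3 eE expr0n/= mul0r oppr0 expR0; ring.
- by move=> y y0; rewrite mulr_ge0// exprn_ge0.
- apply: continuous_subspaceT => y; apply: cvgM; last exact: e_continuous.
  exact: exprn_continuous.
- apply: (@cvgy0_le _ (64 * s ^+ 4 * (s ^+ 2 + 2 * s ^+ 4))) => y y1.
  have y0 : 0 < y by lra.
  rewrite /F3 mulNr normrN ger0_norm; last first.
    by rewrite mulr_ge0// addr_ge0// mulr_ge0// exprn_ge0// ltW.
  apply: (@le_trans _ _ ((s ^+ 2 + 2 * s ^+ 4) * y ^+ 2 * (64 * s ^+ 4 / y ^+ 4))).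
    apply: ler_pM => //; last exact: e_le.
      by rewrite addr_ge0// mulr_ge0// exprn_ge0// ltW.
    rewrite [leRHS]mulrDl lerD2l ler_peMr// ?exprn_ege1//.
    by rewrite mulr_ge0// exprn_ge0// ltW.
  have -> : (s ^+ 2 + 2 * s ^+ 4) * y ^+ 2 * (64 * s ^+ 4 / y ^+ 4) =
     (64 * s ^+ 4 * (s ^+ 2 + 2 * s ^+ 4)) * (y ^+ 2)^-1 by field; rewrite gt_eqF.
  rewrite ler_wpM2l//.
    by rewrite !(mulr_ge0, addr_ge0, exprn_ge0, ltW s0).
  by rewrite lef_pV2 ?posrE ?exprn_gt0// expr2 ler_peMl// ltW.
- by move=> y _; have := dF3 y.
- apply: cvg_at_right_filter; exact: cF3.
- by move=> y _; rewrite derive1E; have dy := dF3 y; rewrite derive_val.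
Qed.

Let F2 y := - (s ^+ 2 * y) * e y.

Let dF2 (y : R) : is_derive y 1 F2 ((y ^+ 2 - s ^+ 2) * e y).
Proof.
have de := e_derive y; apply: is_derive_eq.
by rewrite /GRing.scale/=; field; rewrite gt_eqF.
Qed.

Let cF2 : continuous F2.
Proof.
by move=> y; apply: differentiable_continuous; apply/derivable1_diffP; have := dF2 y.
Qed.

Let c2 : continuous (fun y : R => (y ^+ 2 - s ^+ 2) * e y : R).
Proof.
move=> y; apply: cvgM; last exact: e_continuous.
apply: cvgB; last exact: cvg_cst.
exact: exprn_continuous.
Qed.

(* The variance is read off from [- s^2 y e(y)], a primitive of [(y^2 - s^2) e(y)];
   the half line is cut at [s], where this integrand changes sign, because the
   improper fundamental theorem of calculus wants a constant sign. *)
Let integral_y2_right :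
  (\int[mu]_(y in `[s, +oo[) ((y ^+ 2 - s ^+ 2) * e y)%:E = (s ^+ 3 * e s)%:E)%E.
Proof.
rewrite (@ge0_continuous_FTC2y _ _ F2 s 0).
- by rewrite /F2 -EFinB; congr EFin; ring.
- move=> y sy; rewrite mulr_ge0// subr_ge0 ler_pXn2r// ?nnegrE ?(ltW s0)//.
  exact: le_trans (ltW s0) sy.
- by apply: continuous_subspaceT; exact: c2.
- apply: (@cvgy0_le _ (64 * s ^+ 4 * s ^+ 2)) => y y1.
  have y0 : 0 < y by lra.
  rewrite /F2 mulNr normrN ger0_norm; last by rewrite !mulr_ge0// ?exprn_ge0// ltW.
  apply: (@le_trans _ _ (s ^+ 2 * y * (64 * s ^+ 4 / y ^+ 4))).
    by rewrite ler_wpM2l ?e_le// mulr_ge0// ?exprn_ge0// ltW.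
  have -> : s ^+ 2 * y * (64 * s ^+ 4 / y ^+ 4) =
     (64 * s ^+ 4 * s ^+ 2) * (y ^+ 3)^-1 by field; rewrite gt_eqF.
  rewrite ler_wpM2l//; first by rewrite !mulr_ge0// ?exprn_ge0// ltW.
  by rewrite lef_pV2 ?posrE ?exprn_gt0// exprS ler_peMr ?exprn_ege1// ltW.
- by move=> y _; have := dF2 y.
- apply: cvg_at_right_filter; exact: cF2.
- by move=> y _; rewrite derive1E; have dy := dF2 y; rewrite derive_val.
Qed.

Let integral_y2_left :
  (\int[mu]_(y in `[0%R, s]) ((y ^+ 2 - s ^+ 2) * e y)%:E = (- (s ^+ 3 * e s))%:E)%E.
Proof.
rewrite (@continuous_FTC2 _ _ F2)//.
- by rewrite /F2 -EFinB; congr EFin; ring.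
- by apply: continuous_subspaceT; exact: c2.
- split.
  + by move=> y _; have := dF2 y.
  + apply: cvg_at_right_filter; exact: cF2.
  + apply: cvg_at_left_filter; exact: cF2.
- by move=> y _; rewrite derive1E; have dy := dF2 y; rewrite derive_val.
Qed.

Let D : set (measurableTypeR R) := `[0%R, +oo[%classic.

Let mD : measurable (D : set (measurableTypeR R)). Proof. exact: measurable_itv. Qed.

Let pdfE y : normal_pdf 0 s y = normal_peak s * e y.
Proof. by rewrite normal_pdfE// gt_eqF. Qed.

Let me2 : measurable_fun setT (fun y : R => (y ^+ 2 - s ^+ 2) * e y).
Proof. exact: continuous_measurable_fun. Qed.

Let integrable_e : mu.-integrable D (EFin \o e).
Proof.
have := @integrable_normal_pdf R 0 s.
move=> /(integrableZl measurableT (normal_peak s)^-1) ie.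
apply: (@integrableS _ _ _ mu setT) => //.
apply: eq_integrable ie => //.
move=> y _ /=.
by rewrite pdfE -EFinM mulKf// gt_eqF// normal_peak_gt0// gt_eqF.
Qed.

Let integrable_y3 : mu.-integrable D (EFin \o (fun y => y ^+ 3 * e y)).
Proof.
apply/integrableP; split.
  apply/measurable_EFinP; apply: measurable_funTS; apply: continuous_measurable_fun.
  by move=> y; apply: cvgM; [exact: exprn_continuous|exact: e_continuous].
rewrite (_ : (\int[mu]_(x in D) _)%E = (2 * s ^+ 4)%:E) ?ltry//.
rewrite -integral_y3; apply: eq_integral => y; rewrite inE /D/= in_itv/= andbT => y0.
by rewrite ger0_norm// mulr_ge0// exprn_ge0.
Qed.

(** Since [y^2 <= y^3 + 1] on the half line, the third moment and the total mass dominate this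
    integrand. *)
Let integrable_y2B : mu.-integrable D (EFin \o (fun y => (y ^+ 2 - s ^+ 2) * e y)).
Proof.
have i1 := integrableZl mD (1 + s ^+ 2) integrable_e.
apply: le_integrable (integrableD _ integrable_y3 i1) => //.
- by apply/measurable_EFinP; exact: measurable_funTS.
- move=> y; rewrite /D/= in_itv/= andbT => y0; rewrite /= lee_fin.
  rewrite -mulrDl !normrM (ger0_norm (e_ge0 y)) (@ger0_norm _ (_ + (1 + _))); last first.
    by rewrite !(addr_ge0, exprn_ge0, ltW s0).
  rewrite ler_wpM2r// (le_trans (ler_normB _ _))//.
  rewrite !ger0_norm ?exprn_ge0// ?(ltW s0)// addrA lerD2r.
  have [y1|/ltW y1] := leP 1 y.
    by rewrite (@le_trans _ _ (y ^+ 3))// ?ler_weXn2l// lerDl.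
  by rewrite (@le_trans _ _ 1)// ?exprn_ile1// lerDr exprn_ge0.
Qed.

Let integral_y2B : \int[mu]_(y in D) ((y ^+ 2 - s ^+ 2) * e y) = 0.
Proof.
rewrite /D (@itv_bndbnd_setU _ _ (BLeft 0) (BLeft s) +oo%O) ?bnd_simp ?(ltW s0)//.
have iS (A : set R) : measurable A -> A `<=` D ->
    mu.-integrable A (EFin \o (fun y => (y ^+ 2 - s ^+ 2) * e y)).
  by move=> mA AD; apply: integrableS integrable_y2B => //.
have sub1 : `[0%R, s]%classic `<=` D.
  by move=> y; rewrite /D/= !in_itv/= => /andP[->].
have sub2 : `[s, +oo[%classic `<=` D.
  by move=> y; rewrite /D/= !in_itv/= !andbT; exact/le_trans/ltW.
rewrite Rintegral_setU//; first last.
- apply/disj_setPS => z [/=]; rewrite !in_itv/= => /andP[_ zs] /andP[+ _].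
  by rewrite leNgt zs.
- apply: iS; first by apply: measurableU; exact: measurable_itv.
  by move=> y [/subset_itv_co_cc|]; [exact: sub1|exact: sub2].
rewrite Rintegral_itv_bndo_bndc; last first.
  by apply: iS => //; apply: (subset_trans _ sub1); exact: subset_itv_co_cc.
by rewrite /Rintegral integral_y2_left integral_y2_right/= addNr.
Qed.

Let integral_e : normal_peak s * \int[mu]_(y in D) e y = 2^-1.
Proof.
have sn0 : s != 0 by rewrite gt_eqF.
rewrite -RintegralZl//.
have := @integral_normal_pdf R 0 s; rewrite ge0_symfun_integralT; first last.
- by move=> y /=; rewrite !pdfE !eE sqrrN.
- exact: continuous_normal_pdf.
- by move=> y; exact: normal_pdf_ge0.
have -> : [set x : R | 0 <= x] = D by rewrite /D set_itvcy.
rewrite /Rintegral.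
have -> : (\int[mu]_(x in D) (normal_pdf 0 s x)%:E =
    \int[mu]_(x in D) (normal_peak s * e x)%:E)%E.
  by apply: eq_integral => y _; rewrite pdfE.
have : (\int[mu]_(x in D) (normal_peak s * e x)%:E \is a fin_num)%E.
  apply: integrable_fin_num => //.
  exact: (integrableZl mD (normal_peak s) integrable_e).
by move=> /fineK <-; rewrite -EFinM => -[]/=; lra.
Qed.

Lemma normal_peak_le : normal_peak s <= s^-1.
Proof.
rewrite /normal_peak lef_pV2 ?posrE//; last first.
  by rewrite sqrtr_gt0 -mulrnAr mulr_gt0 ?exprn_gt0// mulrn_wgt0// pi_gt0.
rewrite -[leLHS](ger0_norm (ltW s0)) -sqrtr_sqr ler_wsqrtr// -mulrnAr ler_peMr ?exprn_ge0 ?ltW//.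
by have := @pi_ge2 R; lra.
Qed.

(* Everything is folded onto the half line: [F (u + y) + F (u - y)] has no term of
   order one in [y], which spares the first moment. *)
Lemma Rintegral_half_normal (A c K : R) :
  mu.-integrable D (EFin \o (fun y => (2 * A + c * y ^+ 2 + K * y ^+ 3) * normal_pdf 0 s y)) /\
  \int[mu]_(y in D) ((2 * A + c * y ^+ 2 + K * y ^+ 3) * normal_pdf 0 s y) =
  A + c / 2 * s ^+ 2 + K * (2 * s ^+ 4 * normal_peak s).
Proof.
set p := normal_peak s.
pose f1 y := (c * p) * ((y ^+ 2 - s ^+ 2) * e y).
pose f2 y := (K * p) * (y ^+ 3 * e y).
pose f3 y := ((2 * A + c * s ^+ 2) * p) * e y.
have i1 : mu.-integrable D (EFin \o f1) by exact: (integrableZl mD (c * p) integrable_y2B).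
have i2 : mu.-integrable D (EFin \o f2) by exact: (integrableZl mD (K * p) integrable_y3).
have i3 : mu.-integrable D (EFin \o f3).
  exact: (integrableZl mD ((2 * A + c * s ^+ 2) * p) integrable_e).
have i12 : mu.-integrable D (EFin \o (fun y => f1 y + f2 y)) by exact: (integrableD mD i1 i2).
have E : (fun y => (2 * A + c * y ^+ 2 + K * y ^+ 3) * normal_pdf 0 s y) =
    (fun y => (f1 y + f2 y) + f3 y).
  by apply/funext => y; rewrite pdfE /f1 /f2 /f3 -/p; ring.
rewrite E; split; first exact: (integrableD mD i12 i3).
rewrite RintegralD// RintegralD// !RintegralZl// integral_y2B.
have -> : \int[mu]_(y in D) (y ^+ 3 * e y) = 2 * s ^+ 4 by rewrite /Rintegral integral_y3.
have := integral_e; rewrite -/p => pe.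
by rewrite -[(_ * p * \int[mu]_(y in D) e y)]mulrA pe; field.
Qed.

(** Change of variables is applied with the Radon-Nikodym derivative, which agrees almost everywhere
    with the Gaussian density because both have the same integral over every measurable set. *)
Lemma integral_normal_prob (f : R -> \bar R) : (forall y, 0 <= f y)%E ->
  measurable_fun setT f ->
  (\int[normal_prob 0 s]_y f y = \int[mu]_y (f y * (normal_pdf 0 s y)%:E))%E.
Proof.
move=> f0 mf.
have dom := @normal_prob_dominates R 0 s.
rewrite -(Radon_Nikodym_SigmaFinite.change_of_variables dom f0 measurableT mf).
have mRN := measurable_int _ (Radon_Nikodym_SigmaFinite.f_integrable dom).
have mpdf : measurable_fun setT (fun y => (normal_pdf 0 s y)%:E).
  by apply/measurable_EFinP; exact: measurable_normal_pdf.
apply: ae_eq_integral => //.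
- exact: emeasurable_funM.
- exact: emeasurable_funM.
- apply: ae_eqe_mul2l; apply: integral_ae_eq => //.
  + exact: Radon_Nikodym_SigmaFinite.f_integrable.
  + by move=> E _ mE; rewrite -Radon_Nikodym_SigmaFinite.f_integral.
Qed.

(** In use [A] and [c] are the value and the second derivative of the potential at [u], and [K]
    bounds the remainder. The half-line third moment is at most [2 s^3] because the peak of the
    density is at most [1 / s]. *)
Lemma integral_normal_prob_le (F : R -> R) (u A c K : R) : continuous F ->
  (forall y, 0 <= F y) -> 0 <= K ->
  (forall y, 0 <= y -> F (u + y) + F (u - y) <= 2 * A + c * y ^+ 2 + K * y ^+ 3) ->
  (\int[normal_prob 0 s]_y (F (u + y))%:E <= (A + c / 2 * s ^+ 2 + K * (2 * s ^+ 3))%:E)%E.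
Proof.
move=> cF F0 K0 FK.
have cFu : continuous (fun y => F (u + y)).
  move=> y; apply: continuous_comp; last exact: cF.
  by apply: cvgD; [exact: cvg_cst|exact: cvg_id].
rewrite integral_normal_prob; first last.
- by apply/measurable_EFinP; exact: continuous_measurable_fun.
- by move=> y; rewrite lee_fin.
pose G (y : R) := F (u + y) * normal_pdf 0 s y.
have cG : continuous G.
  move=> y; apply: cvgM; first exact: cFu.
  by apply: continuous_normal_pdf; rewrite gt_eqF.
have G0 y : 0 <= G y by rewrite mulr_ge0// normal_pdf_ge0.
have mG : measurable_fun setT G by exact: continuous_measurable_fun.
have -> : (\int[mu]_y ((F (u + y))%:E * (normal_pdf 0 s y)%:E) =
    \int[mu]_(y in D) (G y + G (- y))%:E)%E.
  have -> : (\int[mu]_y ((F (u + y))%:E * (normal_pdf 0 s y)%:E) = \int[mu]_y (G y)%:E)%E.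
    by apply: eq_integral => y _; rewrite -EFinM.
  rewrite -(setUv D) ge0_integral_setU//=; last 4 first.
  - exact: measurableC.
  - by rewrite setUv; exact/measurable_EFinP.
  - by move=> y _; rewrite lee_fin.
  - exact/disj_setPCl.
  under [RHS]eq_integral do rewrite EFinD.
  rewrite (@ge0_integralD _ _ _ mu D mD); last 4 first.
  - by move=> y _; rewrite lee_fin.
  - by apply/measurable_EFinP; exact: measurable_funTS.
  - by move=> y _; rewrite lee_fin.
  - apply/measurable_EFinP; apply: measurable_funTS; apply: continuous_measurable_fun.
    move=> y; apply: continuous_comp; last exact: cG.
    by apply: cvgN; exact: cvg_id.
  congr (_ + _)%E.
  rewrite /D setCitvr integral_itv_bndo_bndc; last exact/measurable_EFinP/measurable_funTS.
  rewrite -{1}oppr0 ge0_integration_by_substitutionNy//.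
  exact: continuous_subspaceT.
have [iB EB] := Rintegral_half_normal A c K.
have FB (y : R) : D y -> G y + G (- y) <= (2 * A + c * y ^+ 2 + K * y ^+ 3) * normal_pdf 0 s y.
  rewrite /D/= in_itv/= andbT => y0.
  rewrite /G !pdfE [e (- y)]eE sqrrN -eE -mulrDl ler_wpM2r ?FK//.
  by rewrite mulr_ge0// normal_peak_ge0.
apply: (@le_trans _ _ (\int[mu]_(y in D) ((2 * A + c * y ^+ 2 + K * y ^+ 3) * normal_pdf 0 s y)%:E)%E).
  apply: ge0_le_integral => //.
  - by move=> y _; rewrite lee_fin addr_ge0.
  - apply/measurable_EFinP; apply: measurable_funTS; apply: continuous_measurable_fun.
    move=> y; apply: cvgD; first exact: cG.
    apply: continuous_comp; last exact: cG.
    by apply: cvgN; exact: cvg_id.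
  - exact: measurable_int iB.
rewrite -(fineK (integrable_fin_num mD iB)) lee_fin.
rewrite [leLHS](_ : _ = A + c / 2 * s ^+ 2 + K * (2 * s ^+ 4 * normal_peak s)) ?lerD2l//.
rewrite ler_wpM2l// (@le_trans _ _ (2 * s ^+ 4 * s^-1))//; last first.
  by rewrite le_eqVlt; apply/orP; left; apply/eqP; field; rewrite gt_eqF.
by rewrite ler_wpM2l ?normal_peak_le// mulr_ge0// exprn_ge0// ltW.
Qed.

End gaussian.

(** * One Euler step almost preserves the scale function *)

Ltac nonneg := repeat first
  [done | exact: ltW | rewrite invr_ge0 | apply: exprn_ge0 | apply: addr_ge0 | apply: mulr_ge0].

Section step.
Context {R : realType}.
Implicit Types (f : R -> R).

Lemma continuous_itv_bounded f (l r : R) : {within `[l, r], continuous f} ->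
  exists2 M : R, 0 <= M & {in `[l, r], forall z, `|f z| <= M}.
Proof.
move=> cf; have [lr|rl] := leP l r; last first.
  exists 0 => // z; rewrite in_itv/= => /andP[lz zr].
  by have := le_trans lz zr; rewrite leNgt rl.
have cn : {within `[l, r], continuous (fun z => `|f z|)}.
  by move=> u; apply: continuous_comp; [exact: cf|exact: norm_continuous].
by have [c _ maxc] := EVT_max lr cn; exists `|f c|.
Qed.

Lemma derive_within_continuous f (df : R -> R) (l r : R) :
  {in `[l, r], forall z : R, is_derive z 1 f (df z)} -> {within `[l, r], continuous f}.
Proof.
move=> fd; apply: continuous_in_subspaceT => z /set_mem zlr.
apply: differentiable_continuous; apply/derivable1_diffP.
by have := fd z zlr.
Qed.

Lemma mean_value f (df : R -> R) (l r u v : R) :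
  {in `[l, r], forall z : R, is_derive z 1 f (df z)} ->
  u <= v -> l <= u -> v <= r ->
  exists2 c, u <= c <= v & f v - f u = df c * (v - u).
Proof.
move=> fd uv lu vr.
have sub z : u <= z <= v -> z \in `[l, r].
  by rewrite in_itv/= => /andP[uz zv]; rewrite (le_trans lu)//= (le_trans zv).
have [|//|c cuv E] := @MVT_segment _ f df _ _ uv.
- move=> z; rewrite in_itv/= => /andP[/ltW uz /ltW zv].
  by apply: fd; apply: sub; rewrite uz.
- apply: (@derive_within_continuous _ df) => z; rewrite in_itv/= => zuv.
  exact/fd/sub.
- by exists c => //; move: cuv; rewrite in_itv.
Qed.

Lemma mean_value_dist f (df : R -> R) (l r u v : R) :
  {in `[l, r], forall z : R, is_derive z 1 f (df z)} ->
  u \in `[l, r] -> v \in `[l, r] ->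
  exists2 c, c \in `[l, r] /\ `|c - u| <= `|v - u| & f v - f u = df c * (v - u).
Proof.
move=> fd; rewrite !in_itv/= => /andP[lu ur] /andP[lv vr].
have [uv|vu] := leP u v.
  have [c /andP[uc cv] E] := mean_value fd uv lu vr; exists c => //.
  rewrite in_itv/= (le_trans lu)//= (le_trans cv)//; split => //.
  by rewrite !ger0_norm ?subr_ge0// lerD2r.
have [c /andP[vc cu] E] := mean_value fd (ltW vu) lv ur; exists c.
  rewrite in_itv/= (le_trans lv)//= (le_trans cu)//; split => //.
  by rewrite distrC [leRHS]distrC !ger0_norm ?subr_ge0// ?(ltW vu)// lerD2l lerN2.
by rewrite -[LHS]opprB E; ring.
Qed.

(** Odd-order terms cancel in the symmetric sum, so a Lipschitz second derivative already gives a
    cubic error. The mean value theorem is applied to the remainder [psi] as a function of the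
    displacement, then to [f1] between the two symmetric points. *)
Lemma symmetric_taylor f (f1 f2 : R -> R) (l r K u y : R) :
  {in `[l, r], forall z : R, is_derive z 1 f (f1 z)} ->
  {in `[l, r], forall z : R, is_derive z 1 f1 (f2 z)} ->
  {in `[l, r] &, forall v w, `|f2 v - f2 w| <= K * `|v - w|} ->
  0 <= K -> 0 <= y -> l <= u - y -> u + y <= r ->
  f (u + y) + f (u - y) <= 2 * f u + f2 u * y ^+ 2 + 2 * K * y ^+ 3.
Proof.
move=> fd f1d f2K K0 y0 luy uyr.
pose psi (z : R) := f (u + z) + f (u - z) - f2 u * z ^+ 2.
pose dpsi (z : R) := f1 (u + z) - f1 (u - z) - 2 * f2 u * z.
have dpsiE : {in `[0, y], forall z : R, is_derive z 1 psi (dpsi z)}.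
  move=> z; rewrite in_itv/= => /andP[z0 zy].
  have d1 : is_derive (u + z) 1 f (f1 (u + z)).
    by apply: fd; rewrite in_itv/=; apply/andP; split; lra.
  have d2 : is_derive (u - z) 1 f (f1 (u - z)).
    by apply: fd; rewrite in_itv/=; apply/andP; split; lra.
  have D1 : is_derive z 1 (fun z => f (u + z)) (f1 (u + z)).
    have := is_derive1_comp d1 (is_deriveD (is_derive_cst u z 1) (is_derive_id z 1)).
    by rewrite add0r mulr1.
  have D2 : is_derive z 1 (fun z => f (u - z)) (- f1 (u - z)).
    have := @is_derive1_comp _ f (fun z => u - z) z _ _ d2 (is_deriveB (is_derive_cst u z 1) (is_derive_id z 1)).
    by rewrite sub0r mulrN1.
  have D3 : is_derive z 1 (fun z : R => f2 u * z ^+ 2) (2 * f2 u * z).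
    by apply: is_derive_eq; rewrite /GRing.scale/=; ring.
  have := is_deriveB (is_deriveD D1 D2) D3; rewrite /psi /dpsi.
  by [].
have [|||c /andP[c0 cy]] := @mean_value psi dpsi 0 y 0 y dpsiE => //.
rewrite subr0 => E.
have [|||c' /andP[uc' c'u] E'] := @mean_value f1 f2 l r (u - c) (u + c) f1d; try lra.
have lip : `|f2 c' - f2 u| <= K * `|c' - u|.
  by apply: f2K; rewrite in_itv/=; apply/andP; split; lra.
have c'c : `|c' - u| <= c by rewrite ler_norml; apply/andP; split; lra.
have le1 : f2 c' - f2 u <= K * c.
  by rewrite (le_trans (ler_norm _))// (le_trans lip)// ler_wpM2l.
have dle : dpsi c <= 2 * K * y ^+ 2.
  rewrite /dpsi E' (_ : _ - _ = (f2 c' - f2 u) * (2 * c)); last by ring.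
  apply: (@le_trans _ _ (K * c * (2 * c))); first by rewrite ler_wpM2r// mulr_ge0.
  rewrite (_ : K * c * (2 * c) = 2 * K * c ^+ 2); last by ring.
  by rewrite ler_wpM2l ?mulr_ge0// ler_pXn2r// nnegrE.
have : dpsi c * y <= 2 * K * y ^+ 2 * y by rewrite ler_wpM2r.
rewrite -E /psi expr0n/= !(addr0, subr0) mulr0 subr0.
have -> : y ^+ 3 = y ^+ 2 * y by ring.
lra.
Qed.

Definition clamp (l r z : R) := Num.min (Num.max z l) r.

Lemma clamp_id l r z : l <= z -> z <= r -> clamp l r z = z.
Proof. by move=> lz zr; rewrite /clamp (max_idPl lz) (min_idPl zr). Qed.

Lemma clamp_itv l r z : l <= r -> l <= clamp l r z <= r.
Proof. by move=> lr; rewrite /clamp le_min ge_min lexx orbT andbT le_max lexx orbT. Qed.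

Lemma continuous_clamp l r : continuous (clamp l r).
Proof.
move=> z; apply: (@continuous_min _ _ (fun z => Num.max z l) (fun=> r)).
  by apply: (@continuous_max _ _ id (fun=> l)); [exact: cvg_id|exact: cvg_cst].
exact: cvg_cst.
Qed.

Variables (p p1 b : R -> R) (l r K eta : R).
Hypotheses (lr : l < r) (eta0 : 0 < eta) (K0 : 0 <= K).
Hypothesis dp : {in `[l, r], forall z : R, is_derive z 1 p (p1 z)}.
Hypothesis dp1 : {in `[l, r], forall z : R, is_derive z 1 p1 (- 2 * b z * p1 z)}.
Hypothesis p1_ge0 : forall z, 0 <= p1 z.
Hypothesis bK : {in `[l, r] &, forall u v, `|b u - b v| <= K * `|u - v|}.

(* Clamping makes the potential bounded, so that the Taylor bound, valid up to
   distance [eta], extends to all jumps at the price of a cubic term. *)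
Let F z := p r - p (clamp l r z).

Let p_le u v : l <= u -> u <= v -> v <= r -> p u <= p v.
Proof.
move=> lu uv vr; have [c _ E] := mean_value dp uv lu vr.
by rewrite -subr_ge0 E mulr_ge0// subr_ge0.
Qed.

Lemma clamped_potential_ge0 z : 0 <= F z.
Proof.
have /andP[h1 h2] := clamp_itv z (ltW lr).
by rewrite subr_ge0 p_le.
Qed.

Lemma clamped_potential_le z : F z <= p r - p l.
Proof.
have /andP[h1 h2] := clamp_itv z (ltW lr).
by rewrite lerD2l lerN2 p_le.
Qed.

Lemma clamped_potential_nincr u v : u <= v -> F v <= F u.
Proof.
move=> uv; rewrite lerD2l lerN2.
have /andP[h1 h2] := clamp_itv u (ltW lr).
have /andP[h3 h4] := clamp_itv v (ltW lr).
apply: p_le => //.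
rewrite /clamp le_min !ge_min lexx orbT andbT.
apply/orP; left; rewrite ge_max !le_max uv lexx/= orbT; by [].
Qed.

Lemma continuous_clamped_potential : continuous F.
Proof.
move=> z; apply: cvgB; first exact: cvg_cst.
apply: continuous_comp; first exact: continuous_clamp.
apply: differentiable_continuous; apply/derivable1_diffP.
have zlr : clamp l r z \in `[l, r] by rewrite in_itv/= clamp_itv// ltW.
by have := dp zlr.
Qed.

(* The terms of order [q^2] are [f' b + f'' / 2], which vanishes since [p] is a
   scale function. *)
Lemma clamped_potential_step : exists2 C : R, 0 <= C &
  exists2 q0 : R, 0 < q0 & forall q s : R, 0 < q -> q <= q0 ->
    l + 2 * eta <= s -> s <= r - 2 * eta ->
    (\int[normal_prob 0 q]_y (F (s + q ^+ 2 * b s + y))%:E <= (F s + C * q ^+ 3)%:E)%E.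
Proof.
have eta0' := eta0.
have [Mp Mp0 p1M] := continuous_itv_bounded (derive_within_continuous dp1).
have lin : l \in `[l, r] by rewrite in_itv/= lexx ltW.
pose Mb := `|b l| + K * (r - l).
have Mb0 : 0 <= Mb by rewrite addr_ge0// mulr_ge0// subr_ge0 ltW.
have bM z : z \in `[l, r] -> `|b z| <= Mb.
  move=> zlr; rewrite -[b z](subrK (b l)) addrC (le_trans (ler_normD _ _))// lerD2l.
  rewrite (le_trans (bK zlr lin))// ler_wpM2l//.
  by move: zlr; rewrite in_itv/= => /andP[lz zr]; rewrite ger0_norm ?subr_ge0// lerD2r.
pose Lp := 2 * Mb * Mp.
have Lp0 : 0 <= Lp by rewrite !mulr_ge0.
have p1L u v : u \in `[l, r] -> v \in `[l, r] -> `|p1 v - p1 u| <= Lp * `|v - u|.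
  move=> ulr vlr; have [c [clr _] ->] := mean_value_dist dp1 ulr vlr.
  rewrite normrM ler_wpM2r// !normrM normrN (ger0_norm (ler0n _ 2)) /Lp.
  by apply: ler_pM; rewrite ?mulr_ge0// ?ler_wpM2l ?bM// ?p1M.
pose f z := p r - p z; pose f1 z := - p1 z; pose f2 z := 2 * b z * p1 z.
have df : {in `[l, r], forall z : R, is_derive z 1 f (f1 z)}.
  move=> z zlr; have dz := dp zlr.
  by have := is_deriveB (is_derive_cst (p r) z 1) dz; rewrite sub0r.
have df1 : {in `[l, r], forall z : R, is_derive z 1 f1 (f2 z)}.
  move=> z zlr; have dz := dp1 zlr.
  have := is_deriveN dz; rewrite (_ : - _ = f2 z)//.
  by rewrite /f2; ring.
pose K2 := 2 * (Mb * Lp + K * Mp).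
have K20 : 0 <= K2 by rewrite mulr_ge0// addr_ge0// mulr_ge0.
have f2K : {in `[l, r] &, forall v w, `|f2 v - f2 w| <= K2 * `|v - w|}.
  move=> v w vlr wlr.
  rewrite (_ : f2 v - f2 w = 2 * (b v * (p1 v - p1 w) + (b v - b w) * p1 w)); last first.
    by rewrite /f2; ring.
  rewrite normrM (ger0_norm (ler0n _ 2)) /K2 -mulrA ler_wpM2l//.
  rewrite (le_trans (ler_normD _ _))// [leRHS]mulrDl !normrM lerD//.
    by rewrite -mulrA; apply: ler_pM => //; [exact: bM|exact: p1L].
  by rewrite mulrAC; apply: ler_pM => //; [exact: bK|exact: p1M].
have FE z : z \in `[l, r] -> F z = f z.
  by rewrite in_itv/= => /andP[lz zr]; rewrite /F clamp_id.
pose Fm := p r - p l.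
have Fm0 : 0 <= Fm by exact: le_trans (clamped_potential_ge0 l) (clamped_potential_le l).
(* The first two terms serve jumps [y > eta]: there [F (u + y) + F (u - y) <= 2 Fm <= 2 Fm (y /
   eta)^3], and a negative quadratic term is compensated using [y^2 <= y^3 / eta]. The last one is
   the Taylor remainder for [y <= eta]. *)
pose K' := 2 * Fm / eta ^+ 3 + 2 * Mb * Mp / eta + 2 * K2.
have K'0 : 0 <= K'.
  by nonneg.
(* The three terms come from expanding [f u] at [s], from replacing [f2 u] by [f2 s], and from the
   cubic moment; the first two are of order [q^4 <= q^3]. *)
exists (Lp * Mb ^+ 2 + K2 * Mb / 2 + 2 * K').
  by nonneg.
(* Makes the drift move [s] by at most [eta], so that [u] keeps distance [eta] from both ends. *)
exists (Num.min 1 (eta / (Mb + 1))).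
  by rewrite lt_min ltr01 divr_gt0// ltr_wpDl.
move=> q s q0; rewrite le_min => /andP[q1 qeta] ls sr.
set u := s + q ^+ 2 * b s.
have slr : s \in `[l, r].
  rewrite in_itv/=; apply/andP; split; lra.
have q2q : q ^+ 2 <= q by rewrite expr2 ger_pMl.
have q2_ge0 : 0 <= q ^+ 2 by rewrite exprn_ge0// ltW.
have usM : `|q ^+ 2 * b s| <= q ^+ 2 * Mb by rewrite normrM ger0_norm// ler_wpM2l// bM.
have q2Mb : q ^+ 2 * Mb <= eta.
  rewrite (@le_trans _ _ (q * (Mb + 1)))//; first by apply: ler_pM => //; lra.
  by rewrite -ler_pdivlMr// ltr_wpDl.
have us : `|u - s| <= q ^+ 2 * Mb by rewrite /u addrC addKr.
have useta : `|u - s| <= eta by exact: le_trans q2Mb.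
have /andP[us1 us2] : - eta <= u - s <= eta by rewrite -ler_norml.
have ulr : u \in `[l, r] by rewrite in_itv/=; apply/andP; split; lra.
apply: (le_trans (@integral_normal_prob_le _ _ q0 F u (f u) (f2 u) K' _ _ _ _)) => //.
- exact: continuous_clamped_potential.
- exact: clamped_potential_ge0.
- move=> y y0; have [yeta|etay] := leP y eta.
    rewrite !FE; last 2 first.
    + by rewrite in_itv/=; apply/andP; split; lra.
    + by rewrite in_itv/=; apply/andP; split; lra.
    have T : f (u + y) + f (u - y) <= 2 * f u + f2 u * y ^+ 2 + 2 * K2 * y ^+ 3.
      by apply: (symmetric_taylor df df1) => //; lra.
    rewrite (le_trans T)//.
    rewrite lerD2l ler_wpM2r ?exprn_ge0// /K' lerDr; nonneg.
  have fu0 : 0 <= f u by rewrite -FE// clamped_potential_ge0.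
  have f2u : `|f2 u| <= 2 * Mb * Mp.
    rewrite !normrM (ger0_norm (ler0n _ 2)); apply: ler_pM; rewrite ?mulr_ge0//; last exact: p1M.
    by rewrite ler_wpM2l// bM.
  have ey : 1 <= y / eta by rewrite ler_pdivlMr// mul1r ltW.
  have y2 : 0 <= y ^+ 2 by rewrite exprn_ge0.
  have h1 : 2 * Fm <= 2 * Fm / eta ^+ 3 * y ^+ 3.
    rewrite -mulrA -[leLHS]mulr1 ler_wpM2l ?mulr_ge0//.
    by rewrite mulrC -exprVn -exprMn exprn_ege1.
  have h2 : - (f2 u * y ^+ 2) <= 2 * Mb * Mp / eta * y ^+ 3.
    rewrite -mulNr (@le_trans _ _ (2 * Mb * Mp * y ^+ 2))//.
      by rewrite ler_wpM2r// (le_trans _ f2u)// -normrN ler_norm.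
    rewrite (_ : 2 * Mb * Mp / eta * y ^+ 3 = 2 * Mb * Mp * y ^+ 2 * (y / eta)); last first.
      by field; rewrite gt_eqF.
    by rewrite ler_peMr// !mulr_ge0.
  have h3 : 0 <= 2 * K2 * y ^+ 3 by nonneg.
  have := clamped_potential_le (u + y); have := clamped_potential_le (u - y).
  rewrite /K' !mulrDl -/Fm; lra.
rewrite lee_fin FE//.
have [c [clr cs] fus] := mean_value_dist df slr ulr.
have fu : f u <= f s + f1 s * (u - s) + Lp * (q ^+ 2 * Mb) ^+ 2.
  have : (f1 c - f1 s) * (u - s) <= Lp * (q ^+ 2 * Mb) ^+ 2.
    rewrite (le_trans (ler_norm _))// normrM (_ : Lp * _ = Lp * (q ^+ 2 * Mb) * (q ^+ 2 * Mb)); last by ring.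
    apply: ler_pM => //.
    rewrite /f1 -opprD normrN (le_trans (p1L _ _ slr clr))// ler_wpM2l//.
    exact: le_trans us.
  have := fus; lra.
have f2us : f2 u <= f2 s + K2 * (q ^+ 2 * Mb).
  have := f2K _ _ ulr slr => lip.
  have : f2 u - f2 s <= K2 * (q ^+ 2 * Mb).
    by rewrite (le_trans (ler_norm _))// (le_trans lip)// ler_wpM2l.
  lra.
have E : f1 s * (u - s) + f2 s / 2 * q ^+ 2 = 0.
  by rewrite /u (addrC s) addrK /f1 /f2; field.
have q43 : q ^+ 4 <= q ^+ 3 by rewrite [leLHS]exprS ger_pMl// exprn_gt0.
have h4 : f2 u / 2 * q ^+ 2 <= (f2 s + K2 * (q ^+ 2 * Mb)) / 2 * q ^+ 2.
  by rewrite ler_wpM2r// ler_wpM2r// invr_ge0.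
have h5 : Lp * Mb ^+ 2 * q ^+ 4 <= Lp * Mb ^+ 2 * q ^+ 3.
  by rewrite ler_wpM2l//; nonneg.
have h6 : K2 * Mb / 2 * q ^+ 4 <= K2 * Mb / 2 * q ^+ 3.
  by rewrite ler_wpM2l//; nonneg.
have e1 : Lp * (q ^+ 2 * Mb) ^+ 2 = Lp * Mb ^+ 2 * q ^+ 4 by ring.
have e2 : (f2 s + K2 * (q ^+ 2 * Mb)) / 2 * q ^+ 2 = f2 s / 2 * q ^+ 2 + K2 * Mb / 2 * q ^+ 4.
  by field.
rewrite e1 in fu; rewrite e2 in h4.
clear -fu h4 E h5 h6.
move: (f u) (f2 u) (f1 s * (u - s)) (f2 s / 2 * q ^+ 2) fu h4 E => a1 a2 a3 a4 fu h4 E.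
lra.
Qed.

End step.

(** * Pathwise convergence of the stopped Euler scheme *)

Section path.
Context {R : realType}.
Notation mu := (@lebesgue_measure R).
Implicit Types (b a X B : R -> R).

Lemma exists_nat_ge (y : R) : exists N : nat, y <= N%:R.
Proof. by exists (Num.truncn y).+1; exact/ltW/truncnS_gt. Qed.

(** Only [u] is confined to the compact [[0, t]]; [v] may exceed [t], so nothing special happens at
    the right end. Halving the local radius makes room for [v] around [u]. *)
Lemma continuous_itv_unif X (t : R) : {within `[0, +oo[, continuous X} ->
  forall eta : R, 0 < eta -> exists2 delta : R, 0 < delta &
    forall u v : R, 0 <= u -> u <= t -> 0 <= v -> `|u - v| <= delta ->
      `|X u - X v| <= eta.
Proof.
move=> cX eta eta0.
have /compact_near_coveringP/near_covering_withinP cK := @segment_compact R 0 t.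
have /= unif : \forall delta \near (0 : R)^'+, `[0%R, t]%classic `<=`
    (fun u => forall v, 0 <= v -> `|u - v| <= delta -> `|X u - X v| <= eta).
  apply: (cK R (0 : R)^'+ (fun delta u => forall v, 0 <= v -> `|u - v| <= delta ->
      `|X u - X v| <= eta)) => u0 /=; rewrite in_itv/= => /andP[u00 u0t].
  have u0y : u0 \in `[0, +oo[ by rewrite in_itv/= u00.
  have /subspace_continuousP/(_ u0 u0y) := cX.
  move=> /cvgrPdist_lt/(_ (eta / 2)); rewrite divr_gt0// => /(_ isT).
  rewrite /within/= => /nbhs_ballP[e /= e0 eX].
  have e20 : 0 < e / 2 by rewrite divr_gt0.
  exists (ball u0 (e / 2), [set delta : R | delta < e / 2]) => /=.
    split; first exact: nbhsx_ballx.
    exact: nbhs_right_lt.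
  move=> [u delta] [/= uu0 de]; rewrite in_itv/= => /andP[u0' ut] v v0 uv.
  have h1 : `|X u0 - X u| < eta / 2.
    apply: eX; last by rewrite /= in_itv/= u0'.
    by apply: le_ball uu0; lra.
  have h2 : `|X u0 - X v| < eta / 2.
    apply: eX; last by rewrite /= in_itv/= v0.
    move: uu0; rewrite -!ball_normE /= => uu0.
    rewrite -(subrK u u0) -addrA (le_lt_trans (ler_normD _ _))//; lra.
  rewrite -(subrK (X u0) (X u)) -addrA (le_trans (ler_normD _ _))// distrC; lra.
have : \forall delta \near (0 : R)^'+, 0 < delta by exact: nbhs_right_gt.
move=> /filterI/(_ unif)/filter_ex[delta [delta0 H]].
exists delta => // u v u0 ut; apply: H => /=.
by rewrite in_itv/= u0.
Qed.

(** Freezing the scheme outside []lo, hi[] lets its final value tell whether it has left and on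
    which side; [b] is evaluated inside only. *)
Definition euler_step b (lo hi h s y : R) : R :=
  if (lo < s) && (s < hi) then s + h * b s + y else s.

Fixpoint euler b (lo hi h x : R) (W : nat -> R) (k : nat) : R :=
  if k is k'.+1 then euler_step b lo hi h (euler b lo hi h x W k') (W k') else x.

Lemma Rintegral_near_cst (f : R -> R) (c M u v : R) : u <= v ->
  mu.-integrable `]u, v] (EFin \o f) ->
  (forall r, u < r -> r <= v -> `|f r - c| <= M) ->
  `|\int[mu]_(r in `]u, v]) f r - c * (v - u)| <= M * (v - u).
Proof.
move=> uv fi fM.
have mI : measurable (`]u, v]%classic : set (measurableTypeR R)) by exact: measurable_itv.
have Icst z : \int[mu]_(r in `]u, v]) (cst z r) = z * (v - u).
  rewrite Rintegral_cst//= lebesgue_measure_itv/= lte_fin.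
  by case: ltgtP uv => // -> _; rewrite subrr.
have icst z : mu.-integrable `]u, v] (EFin \o cst z).
  apply: measurable_bounded_integrable => //.
    by rewrite /= lebesgue_measure_itv/=; case: ifP => _; rewrite ?ltry.
  exact: bounded_cst.
rewrite -Icst -(RintegralB mI fi (icst c)).
rewrite (le_trans (le_normr_Rintegral _ _))//.
  exact: (integrableB mI fi (icst c)).
rewrite -Icst; apply: le_Rintegral => //.
- apply: integrable_norm.
  exact: (integrableB mI fi (icst c)).
- by move=> r; rewrite /= in_itv/= => /andP[ur rv]; exact: fM.
Qed.

Section error.
Variables (b a X B : R -> R) (m L x K t eps : R).
Hypotheses (mx : m < x) (xL : x < L) (K0 : 0 <= K) (t0 : 0 < t) (eps0 : 0 < eps).
Hypothesis bK : {in `]m, L[ &, forall u v, `|b u - b v| <= K * `|u - v|}.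
Hypothesis ab : {in `]m, L[, a =1 b}.
Hypothesis cX : {within `[0, +oo[, continuous X}.
Hypothesis B0 : B 0 = 0.
Hypothesis eqX : forall s : R, 0 <= s -> (forall r : R, 0 <= r -> r < s -> X r < L) ->
  mu.-integrable `[0, s] (EFin \o (a \o X)) /\
  X s = x + \int[mu]_(r in `[0, s]) a (X r) + B s.

Let h (n : nat) := t / n.+1%:R.
Let W n k := B (k.+1%:R * h n) - B (k%:R * h n).
Let S n := euler b (m + eps) (L - eps) (h n) x (W n).

(* Discrete Gronwall. As long as the scheme is inside the smaller interval, [X]
   stays in [(m, L)] during the next time step, so the equation of [X] involves
   its drift only where it coincides with [b]. *)
Lemma euler_error : exists N, forall n k, (N <= n)%N -> (k <= n.+1)%N ->
  (forall j, (j < k)%N -> m + eps < S n j < L - eps) ->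
  (forall r : R, 0 <= r -> r <= k%:R * h n -> m < X r < L) /\
  `|X (k%:R * h n) - S n k| <= eps / 4.
Proof.
have mx' := mx; have xL' := xL; have eps0' := eps0.
(* [eta] bounds the oscillation of [X] over one time step; Gronwall amplifies it by at most
   [exp (K t)]. *)
pose eta := eps / (4 * expR (K * t)).
have eK1 : 1 <= expR (K * t) by rewrite -expR0 ler_expR mulr_ge0// ltW.
have eta0 : 0 < eta by rewrite divr_gt0// mulr_gt0// expR_gt0.
have etaE : eta * expR (K * t) = eps / 4 by rewrite /eta; field; rewrite gt_eqF// expR_gt0.
have eta_le : eta <= eps / 4 by rewrite -etaE ler_peMr// ltW.
have [delta delta0 Xd] := continuous_itv_unif t cX eta0.
have [N hN] : exists N, forall n, (N <= n)%N -> h n <= delta.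
  have [N tN] := exists_nat_ge (t / delta).
  exists N => n Nn; rewrite /h ler_pdivrMr// mulrC -ler_pdivrMr//.
  by rewrite (le_trans tN)// ler_nat ltnW.
exists N => n k Nn.
have h0 : 0 < h n by rewrite divr_gt0.
have hd := hN n Nn.
have ht j : (j <= n.+1)%N -> j%:R * h n <= t.
  by move=> jn; rewrite /h mulrCA ger_pMr// ler_pdivrMr// mul1r ler_nat.
have X0 : X 0 = x.
  have no r : 0 <= r -> r < 0 -> X r < L by move=> r0; rewrite ltNge r0.
  have [_ ->] := eqX (lexx 0) no.
  by rewrite set_itv1 Rintegral_set1 addr0 B0 addr0.
pose D j := (1 + K * h n) ^+ j.
have D1 j : (j <= n.+1)%N -> D j <= expR (K * t).
  move=> jn; rewrite /D (@le_trans _ _ (expR (K * h n) ^+ j))//.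
    apply: lerXn2r; last exact: expR_ge1Dx.
      by rewrite nnegrE addr_ge0// mulr_ge0// ltW.
    by rewrite nnegrE expR_ge0.
  by rewrite -expRM_natl ler_expR mulrCA ler_wpM2l// ht.
have Deps j : (j <= n.+1)%N -> eta * (D j - 1) <= eps / 4.
  move=> jn; rewrite -etaE ler_wpM2l ?(ltW eta0)//; have := D1 j jn; lra.
(* The bound [eps / 4] alone would not propagate. [eta * (D k - 1)] is the exact solution of
   [e' = e + K h (eta + e)] started at 0. *)
move=> kn Sin; suff [Xin Xerr] : (forall r : R, 0 <= r -> r <= k%:R * h n -> m < X r < L) /\
  `|X (k%:R * h n) - S n k| <= eta * (D k - 1).
  by split => //; exact: le_trans (Deps k kn).
elim: k kn Sin => [|k IH] kn Sin.
  rewrite mul0r; split.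
    by move=> r r0 r0'; rewrite (@le_anti _ _ r 0) ?X0 ?mx ?xL// r0 r0'.
  by rewrite X0 subrr normr0 /D expr0 subrr mulr0.
have [Xin Xerr] := IH (ltnW kn) (fun j jk => Sin j (ltnW jk)).
have /andP[loS Shi] := Sin k (ltnSn k).
have Xerr4 := le_trans Xerr (Deps k (ltnW kn)).
set tk := k%:R * h n in Xin Xerr Xerr4.
have tk0 : 0 <= tk by rewrite mulr_ge0// ltW.
have tkt : tk <= t by exact/ht/ltnW.
set tk1 := k.+1%:R * h n.
have tk1E : tk1 = tk + h n by rewrite /tk1 -natr1 mulrDl mul1r.
have Xosc r : tk <= r -> r <= tk1 -> `|X r - X tk| <= eta.
  move=> tkr rtk1; rewrite distrC; apply: Xd => //; first exact: le_trans tkr.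
  by rewrite distrC ger0_norm ?subr_ge0//; lra.
have Xnew r : tk <= r -> r <= tk1 -> m < X r < L.
  move=> r1 r2; have := Xosc r r1 r2; move: Xerr4.
  by rewrite !ler_norml => /andP[? ?] /andP[? ?]; apply/andP; split; lra.
have Xall r : 0 <= r -> r <= tk1 -> m < X r < L.
  move=> r0 r1; have [rt|/ltW rt] := leP r tk; first exact: Xin.
  exact: Xnew.
split => //.
have tk10 : 0 <= tk1 by rewrite tk1E addr_ge0// ltW.
have [ik Ek] := eqX tk0 (fun r r0 rs => proj2 (andP (Xin r r0 (ltW rs)))).
have [ik1 Ek1] := eqX tk10 (fun r r0 rs => proj2 (andP (Xall r r0 (ltW rs)))).
have iD : \int[mu]_(r in `[0, tk1]) a (X r) - \int[mu]_(r in `[0, tk]) a (X r) =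
    \int[mu]_(r in `]tk, tk1]) a (X r).
  by apply: Rintegral_itvB => //; rewrite bnd_simp// tk1E lerDl ltW.
have SkS : S n k.+1 = S n k + h n * b (S n k) + (B tk1 - B tk).
  by rewrite /S /= /euler_step -/(S n k) loS Shi.
have Skin : S n k \in `]m, L[ by rewrite in_itv/=; apply/andP; split; lra.
have tktk1 : tk <= tk1 by rewrite tk1E lerDl ltW.
have isub : mu.-integrable `]tk, tk1] (EFin \o (a \o X)).
  by apply: integrableS ik1 => //; apply: subset_itvr; rewrite bnd_simp.
have ierr := @Rintegral_near_cst (a \o X) (b (S n k)) (K * (eta + eta * (D k - 1))) tk tk1 tktk1 isub.
have {ierr} := ierr _; rewrite [tk1 - tk](_ : _ = h n); last by rewrite tk1E addrC addKr.
move=> ierr; have {}ierr : `|\int[mu]_(r in `]tk, tk1]) (a \o X) r - b (S n k) * h n| <=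
    K * (eta + eta * (D k - 1)) * h n.
  apply: ierr => r r1 r2; have Xr := Xnew r (ltW r1) r2.
  have Xrin : X r \in `]m, L[ by rewrite in_itv.
  rewrite /= (ab Xrin) (le_trans (bK Xrin Skin))// ler_wpM2l//.
  rewrite -(subrK (X tk) (X r)) -addrA (le_trans (ler_normD _ _))// lerD//.
  by apply: Xosc => //; exact: ltW.
have -> : X tk1 - S n k.+1 = (X tk - S n k) +
   (\int[mu]_(r in `]tk, tk1]) (a \o X) r - b (S n k) * h n).
  rewrite SkS Ek1 Ek -iD; ring.
rewrite (le_trans (ler_normD _ _))//.
have -> : eta * (D k.+1 - 1) = eta * (D k - 1) + K * (eta + eta * (D k - 1)) * h n.
  by rewrite /D exprS; ring.
exact: lerD.
Qed.

Let S_stop n k j : (k <= j)%N -> ~~ (m + eps < S n k < L - eps) -> S n j = S n k.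
Proof.
move=> /subnK <- /negbTE out; elim: (j - k)%N => [//|i IH].
by rewrite addSn /S /= /euler_step -/(S n (i + k)%N) IH out.
Qed.

Lemma euler_reaches : exists N, forall n, (N <= n)%N ->
  ((exists2 s, 0 <= s <= t & X s = L) -> ~~ (m + eps < S n n.+1 < L - eps)) /\
  (L - eps <= S n n.+1 -> exists2 s, 0 <= s <= t & L - 2 * eps <= X s).
Proof.
have [N HN] := euler_error; exists N => n Nn.
have eps0' := eps0.
have h0 : 0 < h n by rewrite divr_gt0.
have hn1 : n.+1%:R * h n = t by rewrite /h mulrCA divff// mulr1.
split.
  move=> [s /andP[s0 st] XsL]; apply/negP => Sin.
  have [] := HN n n.+1 Nn (leqnn _).
    move=> j jn; apply: contraT => out.
    by move: Sin; rewrite (S_stop (ltnW jn) out) (negbTE out).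
  by move=> /(_ s s0); rewrite hn1 => /(_ st); rewrite XsL ltxx andbF.
move=> hiS.
have ex : exists k, ~~ (m + eps < S n k < L - eps).
  by exists n.+1; rewrite negb_and -!leNgt hiS orbT.
have kn : (ex_minn ex <= n.+1)%N.
  case: ex_minnP => k _; apply.
  by rewrite negb_and -!leNgt hiS orbT.
move: kn; case: ex_minnP => k out kmin kn.
have [|_] := HN n k Nn kn.
  move=> j jk; apply: contraT => jout.
  by have := kmin j jout; rewrite leqNgt jk.
rewrite (S_stop kn out) in hiS.
rewrite ler_norml => /andP[kS _]; exists (k%:R * h n); last first.
  by move: (X _) (S n k) kS hiS => p q kS hiS; lra.
by rewrite mulr_ge0 ?(ltW h0)//= -[leRHS]hn1 ler_wpM2r ?ler_nat// ltW.
Qed.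

End error.
End path.

(** * The Euler scheme driven by a Brownian motion *)

Section chain.
Context {R : realType}.

(** Independence makes the joint law coincide with the product measure on rectangles, hence
    everywhere; Tonelli concludes. *)
Lemma integral_independent d (Om : measurableType d) (P : probability Om R)
    d1 d2 (T1 : measurableType d1) (T2 : measurableType d2)
    (N : probability T2 R) (S : Om -> T1) (W : Om -> T2) (f : T1 * T2 -> \bar R) :
  measurable_fun setT S -> measurable_fun setT W ->
  (forall A U, measurable A -> measurable U ->
    P (S @^-1` A `&` W @^-1` U) = (P (S @^-1` A) * N U)%E) ->
  measurable_fun setT f -> (forall z, 0 <= f z)%E ->
  (\int[P]_w f (S w, W w) = \int[P]_w \int[N]_y f (S w, y))%E.
Proof.
move=> mS mW indep mf f0.
pose S' : {mfun Om >-> T1} := HB.pack S (isMeasurableFun.Build _ _ _ _ S mS).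
have mSW : measurable_fun setT (fun w => (S w, W w)) by exact: measurable_fun_pair.
pose SW : {mfun Om >-> (T1 * T2)%type} :=
  HB.pack (fun w => (S w, W w)) (isMeasurableFun.Build _ _ _ _ _ mSW).
have prodE A : measurable A -> (distribution P S' \x N)%E A = distribution P SW A.
  have := @product_measure_unique _ _ _ _ R (distribution P S') N (distribution P SW).
  apply => {}A U mA mU.
  by rewrite /distribution /pushforward -indep.
transitivity (\int[distribution P SW]_z f z)%E.
  by rewrite ge0_integral_distribution.
transitivity (\int[distribution P S' \x N]_z f z)%E.
  by apply: eq_measure_integral => A mA _; apply/esym; exact: prodE.
rewrite fubini_tonelli1// ge0_integral_distribution//.
- exact: measurable_fun_fubini_tonelli_F.
- by move=> s; apply: integral_ge0.
Qed.

(** Written with an indicator, the step involves only [b] restricted to []lo, hi[] and extended by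
    0, which is measurable whatever [b] is elsewhere. *)
Lemma measurable_euler_step (b : R -> R) (lo hi h : R) :
  {in `]lo, hi[, continuous b} ->
  measurable_fun setT (fun z : R * R => euler_step b lo hi h z.1 z.2).
Proof.
move=> cb.
have mb : measurable_fun `]lo, hi[ b.
  apply: open_continuous_measurable_fun; first exact: interval_open.
  exact/in_continuous_mksetP.
have mb' : measurable_fun setT (b \_ `]lo, hi[).
  by apply/(measurable_restrictT _ _).1 => //; exact: measurable_itv.
have -> : (fun z : R * R => euler_step b lo hi h z.1 z.2) =
    (fun z => z.1 + \1_(`]lo, hi[%classic) z.1 * (h * (b \_ `]lo, hi[) z.1 + z.2)).
  apply/funext => -[s y]; rewrite /euler_step/= indicE patchE mem_setE in_itv/=.
  by case: ifP => _; rewrite ?mul1r ?mul0r ?addr0// addrA.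
apply: measurable_funD => //; apply: measurable_funM.
  exact: measurableT_comp.
apply: measurable_funD => //; apply: measurable_funM => //.
exact: measurableT_comp.
Qed.

Section markov.
Context d (Om : measurableType d) (P : probability Om R).
Variables (F : R -> set_system Om) (B : R -> Om -> R).
Hypotheses (filF : filtration F) (bmB : brownian_motion P F B).
Variables (b : R -> R) (lo hi h x : R).
Hypotheses (h0 : 0 < h) (cb : {in `]lo, hi[, continuous b}).

Definition brownian_euler (k : nat) (w : Om) : R :=
  euler b lo hi h x (fun k => B (k.+1%:R * h) w - B (k%:R * h) w) k.
Local Notation S := brownian_euler.

Let kh_ge0 k : 0 <= k%:R * h. Proof. by rewrite mulr_ge0// ltW. Qed.
Let kh_le k : k%:R * h <= k.+1%:R * h.
Proof. by rewrite ler_wpM2r ?ler_nat// ltW. Qed.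

(** Turns adaptedness into measurability for the sigma-algebra generated by [F t], which is [F t]
    itself, so that closure properties of measurable functions apply. *)
Let adapted_measurable (t : R) (Y : Om -> R) : 0 <= t ->
  (forall U, measurable U -> F t (Y @^-1` U)) <->
  measurable_fun (setT : set (g_sigma_algebraType (F t))) Y.
Proof.
move=> t0; have [sF _ _] := filF; have sFt := sF t t0.
split => [FY|mY U mU].
  by move=> _ U mU; rewrite setTI; apply: sub_gen_smallest; exact: FY.
rewrite -(sigma_algebra_id sFt) -[_ @^-1` _]setTI; exact: mY.
Qed.

Lemma adapted_brownian_euler k (U : set R) : measurable U -> F (k%:R * h) (S k @^-1` U).
Proof.
have [_ _ monoF] := filF; have [adB _ _ _ _] := bmB.
move: U; apply/adapted_measurable => //; elim: k => [|k IH].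
  exact: measurable_cst.
have up (Y : Om -> R) t : 0 <= t -> t <= k.+1%:R * h ->
    measurable_fun (setT : set (g_sigma_algebraType (F t))) Y ->
    measurable_fun (setT : set (g_sigma_algebraType (F (k.+1%:R * h)))) Y.
  move=> t0 tk mY; apply/adapted_measurable => // U mU.
  by apply: (monoF t) => //; move: U mU; apply/adapted_measurable.
have mB t : 0 <= t -> t <= k.+1%:R * h ->
    measurable_fun (setT : set (g_sigma_algebraType (F (k.+1%:R * h)))) (B t).
  move=> t0 tk; apply: (up _ t) => //; apply/adapted_measurable => //.
  exact: adB.
have mS := up _ _ (kh_ge0 k) (kh_le k) IH.
have mW : measurable_fun (setT : set (g_sigma_algebraType (F (k.+1%:R * h))))
    (fun w => B (k.+1%:R * h) w - B (k%:R * h) w).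
  by apply: measurable_funB; exact: mB.
exact: (measurableT_comp (measurable_euler_step h cb) (measurable_fun_pair mS mW)).
Qed.

Lemma measurable_brownian_euler k : measurable_fun setT (S k).
Proof.
have [_ subF _] := filF => _ U mU; rewrite setTI.
by apply: subF (kh_ge0 k) _ _; exact: adapted_brownian_euler.
Qed.

(** The one-step Markov property: the new increment is Gaussian and independent of the past that
    determines [S k]. *)
Lemma integral_brownian_euler_succ (f : R -> \bar R) k :
  measurable_fun setT f -> (forall y, 0 <= f y)%E ->
  (\int[P]_w f (S k.+1 w) =
   \int[P]_w \int[normal_prob 0 (Num.sqrt h)]_y f (euler_step b lo hi h (S k w) y))%E.
Proof.
move=> mf f0.
have [_ subF _] := filF; have [adB _ _ gaussB indB] := bmB.
have klt : k%:R * h < k.+1%:R * h by rewrite ltr_pM2r// ltr_nat.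
have mB t : 0 <= t -> measurable_fun setT (B t).
  by move=> t0 _ U mU; rewrite setTI; exact: (subF t t0 _ (adB t t0 U mU)).
pose W := B (k.+1%:R * h) \- B (k%:R * h).
have mW : measurable_fun setT W by apply: measurable_funB; exact: mB.
have indep (A : set R) (U : set (measurableTypeR R)) : measurable A -> measurable U ->
    P (S k @^-1` A `&` W @^-1` U) =
    (P (S k @^-1` A) * normal_prob 0 (Num.sqrt h) U)%E.
  move=> mA mU.
  have hE : k.+1%:R * h - k%:R * h = h by rewrite -mulrBl -natr1 addrC addKr mul1r.
  have E : P (W @^-1` U) = normal_prob 0 (Num.sqrt h) U.
    have -> : Num.sqrt h = Num.sqrt (k.+1%:R * h - k%:R * h) by rewrite hE.
    exact: (gaussB _ _ (kh_ge0 k) klt U mU).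
  have I : P (S k @^-1` A `&` W @^-1` U) = (P (S k @^-1` A) * P (W @^-1` U))%E :=
    indB _ _ (kh_ge0 k) klt _ _ (adapted_brownian_euler k mA) mU.
  by rewrite I E.
have mg : measurable_fun setT (fun z : R * R => f (euler_step b lo hi h z.1 z.2)).
  by apply: measurableT_comp => //; exact: measurable_euler_step.
exact: (@integral_independent _ _ P _ _ R (measurableTypeR R) (normal_prob 0 (Num.sqrt h)) (S k) W
  (fun z => f (euler_step b lo hi h z.1 z.2)) (measurable_brownian_euler k) mW indep mg (fun z => f0 _)).
Qed.

End markov.

(** Induction with [f] generalized: one step replaces [f] by its Gaussian transition, a function
    that no longer mentions the probability space. *)
Lemma integral_brownian_euler_eq d (Om : measurableType d) (P : probability Om R)
    (F : R -> set_system Om) (B : R -> Om -> R)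
    d' (Om' : measurableType d') (P' : probability Om' R)
    (F' : R -> set_system Om') (B' : R -> Om' -> R)
    (b : R -> R) (lo hi h x : R) (k : nat) (f : R -> \bar R) :
  filtration F -> brownian_motion P F B ->
  filtration F' -> brownian_motion P' F' B' ->
  0 < h -> {in `]lo, hi[, continuous b} ->
  measurable_fun setT f -> (forall y, 0 <= f y)%E ->
  (\int[P]_w f (brownian_euler B b lo hi h x k w) =
   \int[P']_w f (brownian_euler B' b lo hi h x k w))%E.
Proof.
move=> fF bB fF' bB' h0 cb; elim: k f => [|k IH] f mf f0.
  by rewrite /brownian_euler/= !integral_cst//= !probability_setT.
rewrite (@integral_brownian_euler_succ _ _ P F B fF bB b lo hi h x h0 cb f k mf f0).
rewrite (@integral_brownian_euler_succ _ _ P' F' B' fF' bB' b lo hi h x h0 cb f k mf f0).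
apply: (IH (fun s => \int[normal_prob 0 (Num.sqrt h)]_y f (euler_step b lo hi h s y))%E).
  apply: (@measurable_fun_fubini_tonelli_F _ _ _ _ R (normal_prob 0 (Num.sqrt h))
    (fun z => f (euler_step b lo hi h z.1 z.2))) => //.
  by apply: measurableT_comp => //; exact: measurable_euler_step.
by move=> y; apply: integral_ge0.
Qed.

End chain.

(** * Hitting times *)

Section generic.
Context {R : realType} {d : measure_display} {Om : measurableType d}.
Variable P : probability Om R.

(** [A] is almost surely contained in the lower limit of the [E n], and the tail intersections [V N]
    increase to that limit. Upper bounds are obtained by applying this to complements. *)
Lemma le_measure_eventually (A : set Om) (E : nat -> set Om) :
  measurable A -> (forall n, measurable (E n)) ->
  {ae P, forall w, A w -> exists N, forall n, (N <= n)%N -> E n w} ->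
  forall e : R, 0 < e -> exists N, forall n, (N <= n)%N ->
    fine (P A) <= fine (P (E n)) + e.
Proof.
move=> mA mE [Z [mZ Z0 AZ]] e e0.
pose V N := \bigcap_(n in [set n | (N <= n)%N]) E n.
have mV N : measurable (V N) by apply: bigcap_measurable => [|n _]; [exists N => /=|exact: mE].
have mUV : measurable (\bigcup_N V N) by exact: bigcup_measurable.
have cV : P (V N) @[N --> \oo] --> P (\bigcup_N V N).
  apply: nondecreasing_cvg_mu => // N M NM; apply/subsetPset => w VN n /= Mn.
  by apply: VN; exact: leq_trans Mn.
have PA : (P A <= P (\bigcup_N V N))%E.
  rewrite -[leRHS]adde0 -Z0 (@le_trans _ _ (P (\bigcup_N V N `|` Z)))//; last exact: measureU2.
  apply: le_measure; rewrite ?inE//; first exact: measurableU.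
  move=> w Aw; have [Zw|nZ] := pselect (Z w); [by right|left].
  have [H|nH] := pselect (A w -> exists N, forall n, (N <= n)%N -> E n w).
    by have [N HN] := H Aw; exists N => // n /= Nn; exact: HN.
  by exfalso; apply: nZ; apply: AZ.
have fV : fine (P (V N)) @[N --> \oo] --> fine (P (\bigcup_N V N)).
  by apply: fine_cvg; rewrite fineK// fin_num_measure.
move/cvgrPdist_lt : fV => /(_ e e0) [N _ HN]; exists N => n Nn.
have := HN n Nn; rewrite /= ltr_norml => /andP[_].
have PAr : fine (P A) <= fine (P (\bigcup_N V N)) by rewrite fine_le// ?fin_num_measure.
have PVr : fine (P (V n)) <= fine (P (E n)).
  rewrite fine_le// ?fin_num_measure//; apply: le_measure; rewrite ?inE//.
  by move=> w; apply => /=.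
lra.
Qed.

Implicit Types X : R -> Om -> R.

(** A countable description: for every tolerance, some point of some uniform grid of [[0, t]] is
    above the level up to that tolerance. The maximum on [[0, t]], which is attained, gives the
    converse. *)
Lemma measurable_reaches X (t a : R) : 0 < t ->
  (forall s, 0 <= s -> measurable_fun setT (X s)) -> continuous_paths X ->
  measurable [set w | exists2 s, 0 <= s <= t & a <= X s w].
Proof.
move=> t0 mX cX.
have -> : [set w | exists2 s, 0 <= s <= t & a <= X s w] =
    \bigcap_m \bigcup_n \bigcup_(k in [set k | (k <= n.+1)%N])
      (X (k%:R * (t / n.+1%:R)) @^-1` `]a - m.+1%:R^-1, +oo[).
  apply/seteqP; split => w /=.
    move=> [s /andP[s0 st] aX] m _.
    have m0 : 0 < (m.+1%:R^-1 : R) / 2 by rewrite divr_gt0// invr_gt0.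
    have [delta delta0 Xd] := continuous_itv_unif t (cX w) m0.
    have [n hn] : exists n, t / n.+1%:R <= delta.
      have [N tN] := exists_nat_ge (t / delta).
      exists N; rewrite ler_pdivrMr// mulrC -ler_pdivrMr//.
      by rewrite (le_trans tN)// ler_nat.
    set h := t / n.+1%:R in hn.
    have h0 : 0 < h by rewrite divr_gt0.
    have /andP[k1 k2] := truncn_itv (divr_ge0 s0 (ltW h0)).
    exists n => //; exists (Num.truncn (s / h)) => /=.
      rewrite -(ler_nat R) (le_trans k1)// ler_pdivrMr// /h mulrCA divff// mulr1.
      exact: st.
    rewrite in_itv/= andbT.
    have kh : (Num.truncn (s / h))%:R * h <= s by rewrite -ler_pdivlMr.
    have kh' : s < (Num.truncn (s / h)).+1%:R * h by rewrite -ltr_pdivrMr.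
    have : `|X s w - X ((Num.truncn (s / h))%:R * h) w| <= m.+1%:R^-1 / 2.
      apply: Xd => //; first by rewrite mulr_ge0// ltW.
      rewrite ger0_norm ?subr_ge0// (le_trans _ hn)//.
      by rewrite -natr1 mulrDl mul1r addrC in kh'; rewrite lerBlDr ltW.
    rewrite -/h; clear -aX m0; move: (X _ w) (X _ w) aX => p q aX.
    rewrite ler_norml => /andP[_]; move: (m.+1%:R^-1 : R) m0 => r r0; lra.
  move=> H; have cw : {within `[0, t], continuous (X^~ w)}.
    apply: continuous_subspaceW (cX w) => s /=.
    by rewrite !in_itv/= andbT => /andP[].
  have [c] := EVT_max (ltW t0) cw; rewrite in_itv/= => c0t maxc.
  exists c => //; apply/ler_addgt0Pr => e e0.
  have [N eN] := exists_nat_ge e^-1.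
  have [n _ [k /= kn]] := H N I.
  rewrite in_itv/= andbT ltrBlDr => aX.
  have kt : k%:R * (t / n.+1%:R) \in `[0, t].
    rewrite in_itv/= mulr_ge0 ?divr_ge0 ?(ltW t0)//=.
    by rewrite mulrCA ger_pMr// ler_pdivrMr// mul1r ler_nat.
  rewrite (le_trans (ltW aX))// lerD ?maxc//.
  rewrite -[leRHS]invrK lef_pV2 ?posrE ?invr_gt0//.
  by rewrite (le_trans eN)// ler_nat.
apply: bigcapT_measurable => m; apply: bigcup_measurable => n _.
apply: bigcup_measurable => k _.
have kt0 : 0 <= k%:R * (t / n.+1%:R) by rewrite mulr_ge0// divr_ge0// ltW.
by rewrite -[X in measurable X]setTI; exact: (mX _ kt0 measurableT _ (measurable_itv _)).
Qed.

(** The infimum is attained. If [L] is not met on [[0, t]], continuity at [t] delays the hitting by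
    some [e > 0], so the infimum exceeds [t]. *)
Lemma hitting_time_le X (L t : R) w : continuous_paths X ->
  (hitting_time X L w <= t%:E)%E <-> exists2 s, 0 <= s <= t & X s w = L.
Proof.
move=> cX; split; last first.
  move=> [s /andP[s0 st] XL]; apply: (@le_trans _ _ s%:E); last by rewrite lee_fin.
  by apply: ereal_inf_lbound; exists s.
move=> Tt; apply: contrapT => no.
have t0 : 0 <= t.
  rewrite -lee_fin (le_trans _ Tt)//; apply: le_ereal_inf_tmp => _ [s [s0 _] <-].
  by rewrite lee_fin.
have XtL : X t w != L by apply/eqP => XtL; apply: no; exists t; rewrite ?t0/=.
have tin : t \in `[0, +oo[ by rewrite in_itv/= t0.
have /subspace_continuousP/(_ t tin) := cX w.
have e0 : 0 < `|X t w - L| by rewrite normr_gt0 subr_eq0.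
move=> /cvgrPdist_lt/(_ _ e0); rewrite /within/= => /nbhs_ballP[e /= e1 eX].
have : ((t + e)%:E <= t%:E)%E.
  apply: le_trans Tt; apply: le_ereal_inf_tmp => _ [s [s0 XsL] <-]; rewrite lee_fin.
  rewrite leNgt; apply/negP => ste.
  have [st|ts] := leP s t; first by apply: no; exists s => //; rewrite s0.
  have : `|X t w - X s w| < `|X t w - L|.
    apply: eX; last by rewrite /= in_itv/= s0.
    by rewrite -ball_normE/= distrC ger0_norm; lra.
  by rewrite XsL ltxx.
by rewrite lee_fin; lra.
Qed.

Lemma hitting_time_ge X (L s : R) w : (forall r, 0 <= r -> r < s -> X r w != L) ->
  (s%:E <= hitting_time X L w)%E.
Proof.
move=> XL; apply: le_ereal_inf_tmp => _ [r [r0 XrL] <-]; rewrite lee_fin leNgt.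
by apply/negP => rs; have := XL r r0 rs; rewrite XrL eqxx.
Qed.

(** By the intermediate value theorem, [L] is met as soon as the path has been on both sides of
    it. *)
Lemma measurable_hitting_time_le X (L t : R) : 0 < t ->
  (forall s, 0 <= s -> measurable_fun setT (X s)) -> continuous_paths X ->
  measurable [set w | (hitting_time X L w <= t%:E)%E].
Proof.
move=> t0 mX cX.
have -> : [set w | (hitting_time X L w <= t%:E)%E] =
    [set w | exists2 s, 0 <= s <= t & L <= X s w] `&`
    [set w | exists2 s, 0 <= s <= t & - L <= - X s w].
  apply/seteqP; split => w /=.
    by move=> /(hitting_time_le _ _ _ cX)[s st XL]; split; exists s; rewrite ?XL.
  move=> [[u /andP[u0 ut] LX] [v /andP[v0 vt]]]; rewrite lerN2 => XL.
  apply/(hitting_time_le _ _ _ cX).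
  have cw l r : 0 <= l -> {within `[l, r], continuous (X^~ w)}.
    move=> l0; apply: continuous_subspaceW (cX w) => s /=.
    by rewrite !in_itv/= andbT => /andP[ls _]; exact: le_trans ls.
  have [uv|/ltW vu] := leP u v.
  - have [|c] := @IVT _ (X^~ w) u v L uv (cw _ _ u0).
      by rewrite ge_min le_max XL LX orbT.
    rewrite in_itv/= => /andP[uc cv] XcL; exists c => //.
    by rewrite (le_trans u0)//= (le_trans cv).
  - have [|c] := @IVT _ (X^~ w) v u L vu (cw _ _ v0).
      by rewrite ge_min le_max XL LX orbT.
    rewrite in_itv/= => /andP[vc cu] XcL; exists c => //.
    by rewrite (le_trans v0)//= (le_trans cu).
apply: measurableI; first exact: measurable_reaches.
apply: (@measurable_reaches (fun s w => - X s w)) => //.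
- by move=> s s0; apply: measurable_funN; exact: mX.
- by move=> w s; apply: continuousN; exact: cX.
Qed.

End generic.

(** * Exit of the scheme through the lower end *)

Section exit_low.
Context {R : realType} {d : measure_display} {Om : measurableType d}.
Variables (P : probability Om R) (F : R -> set_system Om) (B : R -> Om -> R).
Hypotheses (filF : filtration F) (bmB : brownian_motion P F B).
Variables (b : R -> R) (lo hi h x : R).
Hypotheses (h0 : 0 < h) (cb : {in `]lo, hi[, continuous b}).
Variables (G : R -> R) (c : R).
Hypotheses (cG : continuous G) (G0 : forall s, 0 <= G s) (c0 : 0 <= c).
Hypothesis stepG : forall s, lo < s -> s < hi ->
  (\int[normal_prob 0 (Num.sqrt h)]_y (G (s + h * b s + y))%:E <= (G s + c)%:E)%E.
Local Notation S := (brownian_euler B b lo hi h x).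

Let mG : measurable_fun setT (EFin \o G).
Proof. by apply/measurable_EFinP; exact: continuous_measurable_fun. Qed.

Let mGS k : measurable_fun setT (fun w => (G (S k w))%:E).
Proof. exact: (measurableT_comp mG (measurable_brownian_euler filF bmB x h0 cb k)). Qed.

(** [G] is a supermartingale up to [c] per step: [stepG] inside the interval, and no change where
    the scheme is frozen. *)
Lemma integral_potential_euler k :
  (\int[P]_w (G (S k w))%:E <= (G x + k%:R * c)%:E)%E.
Proof.
elim: k => [|k IH].
  by rewrite mul0r addr0 /brownian_euler/= integral_cst//= probability_setT mule1.
rewrite (@integral_brownian_euler_succ _ _ _ _ _ _ filF bmB b lo hi h x h0 cb (EFin \o G) k mG);
  last by move=> y; rewrite lee_fin.
apply: (@le_trans _ _ (\int[P]_w ((G (S k w))%:E + c%:E))%E).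
  apply: ge0_le_integral => //.
  - by move=> w _; apply: integral_ge0 => y _; rewrite lee_fin.
  - have mg : measurable_fun setT (fun z : R * R => (G (euler_step b lo hi h z.1 z.2))%:E).
      by apply: (measurableT_comp mG); exact: measurable_euler_step.
    have mI := @measurable_fun_fubini_tonelli_F _ _ R (measurableTypeR R) R
      (normal_prob 0 (Num.sqrt h)) (fun z => (G (euler_step b lo hi h z.1 z.2))%:E) mg
      (fun z => G0 _).
    exact: (measurableT_comp mI (measurable_brownian_euler filF bmB x h0 cb k)).
  - by apply: emeasurable_funD.
  - move=> w _; rewrite -EFinD /euler_step/=.
    have [/andP[loS Shi]|/negPf out] := boolP ((lo < S k w) && (S k w < hi)).
      exact: stepG.
    by rewrite integral_cst//= probability_setT mule1 lee_fin lerDl.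
rewrite ge0_integralD//; last first.
  by move=> w _; rewrite lee_fin.
rewrite integral_cst//= probability_setT mule1 -natr1 mulrDl mul1r addrA EFinD.
exact: leeD2r.
Qed.

(** Markov's inequality, as [G] is at least [G lo] below [lo]. *)
Lemma euler_exit_low k : (forall s, s <= lo -> G lo <= G s) ->
  fine (P [set w | S k w <= lo]) * G lo <= G x + k%:R * c.
Proof.
move=> Glo; rewrite -lee_fin (le_trans _ (integral_potential_euler k))//.
have mS := measurable_brownian_euler filF bmB x h0 cb k.
have mlo : measurable [set w | S k w <= lo].
  have -> : [set w | S k w <= lo] = S k @^-1` `]-oo, lo].
    by apply/seteqP; split => w /=; rewrite in_itv.
  by rewrite -[X in measurable X]setTI; exact: (mS measurableT _ (measurable_itv _)).
have mind : measurable_fun setT (fun w => (\1_[set w | S k w <= lo] w : R)%:E).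
  by apply/measurable_EFinP; exact: measurable_indic.
have -> : (fine (P [set w | S k w <= lo]) * G lo)%:E =
    (\int[P]_w ((G lo)%:E * (\1_[set w | S k w <= lo] w)%:E))%E.
  rewrite ge0_integralZl//; [|by rewrite lee_fin].
  by rewrite integral_indic// setIT EFinM fineK ?fin_num_measure// muleC.
apply: ge0_le_integral => //.
- by move=> w _; rewrite mule_ge0// lee_fin.
- exact: measurable_funeM.
- move=> w _; rewrite -EFinM lee_fin indicE; have [|_] := boolP (w \in _).
    by rewrite inE mulr1; exact: Glo.
  by rewrite mulr0.
Qed.

End exit_low.

(** * Comparison of the hitting times of two diffusions *)

Section comparison.
Context {R : realType}.

Lemma weak_solution_untilW d (Om : measurableType d) (P : probability Om R)
    (a : R -> R) (x : R) (T T' : Om -> \bar R) X :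
  (forall w, (T w <= T' w)%E) ->
  weak_solution_until P a x T' X -> weak_solution_until P a x T X.
Proof.
move=> TT' [F [B [fF bB aX cX eqX]]]; exists F, B; split => //.
apply: filterS eqX => w eqX t t0 tT; apply: eqX => //.
exact: le_trans (TT' w).
Qed.

Lemma weak_solution_euler d (Om : measurableType d) (P : probability Om R)
    (a b : R -> R) (x L m K t : R) X :
  m < x -> x < L -> 0 <= K -> 0 < t ->
  {in `]m, L[ &, forall u v, `|b u - b v| <= K * `|u - v|} ->
  {in `]m, L[, a =1 b} ->
  weak_solution_until P a x (hitting_time X L) X ->
  exists F B, [/\ filtration F, brownian_motion P F B,
    continuous_paths X /\ {ae P, forall w, X 0 w = x},
    forall s, 0 <= s -> measurable_fun setT (X s) &
    forall eps, 0 < eps -> {ae P, forall w, exists N, forall n, (N <= n)%N ->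
      let S := brownian_euler B b (m + eps) (L - eps) (t / n.+1%:R) x n.+1 w in
      ((hitting_time X L w <= t%:E)%E -> ~~ (m + eps < S < L - eps)) /\
      (L - eps <= S -> exists2 s, 0 <= s <= t & L - 2 * eps <= X s w)}].
Proof.
move=> mx xL K0 t0 bK ab [F [B [fF bB aX cX eqX]]]; exists F, B; split => //.
- split => //; have [_ _ B0 _ _] := bB.
  apply: filterS2 B0 eqX => w B0 /(_ 0 (lexx 0))[|_ ->].
    by apply: hitting_time_ge => r r0; rewrite ltNge r0.
  by rewrite set_itv1 Rintegral_set1 addr0 B0 addr0.
- have [_ subF _] := fF => s s0 _ U mU.
  by rewrite setTI; exact: (subF s s0 _ (aX s s0 U mU)).
move=> eps eps0; have [_ _ B0 _ _] := bB.
apply: filterS2 B0 eqX => w B0 eqX.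
have [|N HN] := @euler_reaches R b a (X^~ w) (B^~ w) m L x K t eps mx xL K0 t0 eps0 bK ab (cX w) B0.
  move=> s s0 XL; apply: eqX => //; apply: hitting_time_ge => r r0 rs.
  by rewrite lt_eqF// XL.
exists N => n Nn; have [h1 h2] := HN n Nn; split => //.
by move=> /(hitting_time_le _ _ _ cX); exact: h1.
Qed.

Variables (b : R -> R) (x L : R).
Hypotheses (Cb : C1_upto b L) (b0 : lebesgue_measure.-integrable `[L, 0] (EFin \o b)).
Local Notation p := (scale_fun b).

Lemma chain_exit_low d (Om : measurableType d) (P : probability Om R) F B (m t eps : R) :
  filtration F -> brownian_motion P F B -> 0 < t -> 0 < eps ->
  m + eps < x -> x < L - eps ->
  forall e, 0 < e -> exists N, forall n, (N <= n)%N ->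
  fine (P [set w | brownian_euler B b (m + eps) (L - eps) (t / n.+1%:R) x n.+1 w <= m + eps])
  <= (p L - p x) / (p x - p (m + eps)) + e.
Proof.
move=> fF bB t0 eps0 mx xL e e0.
(* The window leaves [eps / 2], twice the [eta = eps / 4] of the one-step estimate, on each side of
   the interval of the scheme, and stays strictly below [L], where p is differentiable. *)
pose l := m + eps / 2; pose r := L - eps / 2.
have rL : r < L by rewrite /r; lra.
have lr : l < r by rewrite /l /r; lra.
have lm : m < l by rewrite /l; lra.
have eps4 : 0 < eps / 4 by lra.
have [K K0 bK] := C1_upto_lipschitz m Cb.
have inL z : z \in `[l, r] -> z < L by rewrite in_itv/= => /andP[_ zr]; lra.
have bKlr : {in `[l, r] &, forall u v, `|b u - b v| <= K * `|u - v|}.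
  by move=> u v; rewrite !in_itv/= => /andP[? ?] /andP[? ?];
    apply: bK; rewrite in_itv/=; apply/andP; split; lra.
have dp : {in `[l, r], forall z : R, is_derive z 1 p (expR (- 2 * beta b z))}.
  by move=> z /inL zL; exact: (scale_fun_derive Cb b0).
have dp1 : {in `[l, r], forall z : R, is_derive z 1 (fun u => expR (- 2 * beta b u))
    (- 2 * b z * expR (- 2 * beta b z))}.
  by move=> z /inL zL; exact: (expbeta_derive Cb b0).
have p1_ge0 z : 0 <= expR (- 2 * beta b z) by exact: expR_ge0.
pose G z := p r - p (clamp l r z).
have [C C0 [q0 q00 HC]] := clamped_potential_step lr eps4 K0 dp dp1 p1_ge0 bKlr.
have Glo_gt : 0 < p x - p (m + eps) by rewrite subr_gt0 (scale_fun_lt Cb b0)//; lra.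
have xl : clamp l r x = x by rewrite clamp_id// /l /r; lra.
have lol : clamp l r (m + eps) = m + eps by rewrite clamp_id// /l /r; lra.
have pxr : p x <= p r by apply/ltW/(scale_fun_lt Cb b0); rewrite /r; lra.
have prL : p r <= p L by apply/ltW/(scale_fun_lt Cb b0).
have [N1 hN1] := exists_nat_ge (t / q0 ^+ 2).
(* The error allowed over all steps: [n + 1] times [C h^(3/2)] is [C t sqrt h], which [N2] keeps
   below [D]; the [+ 1] in the quotient guards against [C = 0]. *)
pose D := e * (p x - p (m + eps)).
have D0 : 0 < D by rewrite mulr_gt0.
have [N2 hN2] := exists_nat_ge (t / (D / (C * t + 1)) ^+ 2).
have Ct0 : 0 < C * t + 1 by rewrite ltr_wpDl// mulr_ge0// ltW.
exists (maxn N1 N2) => n; rewrite geq_max => /andP[N1n N2n].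
set h := t / n.+1%:R.
have h0 : 0 < h by rewrite divr_gt0.
have sq0 : 0 < Num.sqrt h by rewrite sqrtr_gt0.
have small (q : R) (N : nat) : 0 < q -> t / q ^+ 2 <= N%:R -> (N <= n)%N -> Num.sqrt h <= q.
  move=> q1 tq Nn; rewrite -[leRHS](ger0_norm (ltW q1)) -sqrtr_sqr ler_wsqrtr//.
  rewrite /h ler_pdivrMr// mulrC -ler_pdivrMr ?exprn_gt0// (le_trans tq)// ler_nat.
  exact: leqW.
have s1 := small q0 N1 q00 hN1 N1n.
have s2 := small (D / (C * t + 1)) N2 (divr_gt0 D0 Ct0) hN2 N2n.
have sqh : Num.sqrt h ^+ 2 = h by rewrite sqr_sqrtr// ltW.
have cb : {in `]m + eps, L - eps[, continuous b}.
  move=> z; rewrite in_itv/= => /andP[_ zL].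
  have /continuous_within_itvNycP[cb _] := C1_upto_continuous Cb.
  by apply: cb; rewrite in_itv/=; lra.
have stepG s : m + eps < s -> s < L - eps ->
    (\int[normal_prob 0 (Num.sqrt h)]_y (G (s + h * b s + y))%:E <=
     (G s + C * Num.sqrt h ^+ 3)%:E)%E.
  move=> s3 s4; have := HC (Num.sqrt h) s sq0 s1; rewrite sqh; apply.
    by rewrite /l; lra.
  by rewrite /r; lra.
have G0 s : 0 <= G s by exact: (clamped_potential_ge0 lr dp).
have cG : continuous G by exact: (continuous_clamped_potential lr dp).
have c0 : 0 <= C * Num.sqrt h ^+ 3 by rewrite mulr_ge0// exprn_ge0// ltW.
have Glo s : s <= m + eps -> G (m + eps) <= G s.
  exact: (clamped_potential_nincr lr dp).
have := euler_exit_low fF bB x h0 cb cG G0 c0 stepG n.+1 Glo.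
set Q := fine _; rewrite /G xl lol => HQ.
have nC : n.+1%:R * (C * Num.sqrt h ^+ 3) <= D.
  have -> : n.+1%:R * (C * Num.sqrt h ^+ 3) = C * t * Num.sqrt h.
    have <- : n.+1%:R * h = t by rewrite /h mulrCA divff ?mulr1// pnatr_eq0.
    by rewrite exprS sqh; ring.
  rewrite (@le_trans _ _ ((C * t + 1) * Num.sqrt h))//.
    by rewrite ler_wpM2r ?ltW// ltrDl.
  by rewrite mulrC -ler_pdivlMr.
have Q0 : 0 <= Q by rewrite fine_ge0.
rewrite -lerBlDr ler_pdivlMr// mulrBl -/D.
(* Replacing [p r] by the smaller [p x] gives a denominator free of the window. *)
have : Q * (p x - p (m + eps)) <= Q * (p r - p (m + eps)) by rewrite ler_wpM2l// lerD2r.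
lra.
Qed.

Lemma fine_probability_setC d (Om : measurableType d) (P : probability Om R) A :
  measurable A -> fine (P (~` A)) = 1 - fine (P A).
Proof.
move=> mA; rewrite probability_setC// -[P A in LHS]fineK ?fin_num_measure//.
Qed.

(** A path started below [L] that misses [L] on [[0, t]] has its maximum strictly below [L], hence
    eventually below [L - 2 / (n + 1)]. *)
Lemma reaches_cdf_le d (Om : measurableType d) (P : probability Om R) (t : R) X :
  0 < t -> x < L -> continuous_paths X ->
  (forall s, 0 <= s -> measurable_fun setT (X s)) ->
  {ae P, forall w, X 0 w = x} ->
  forall e, 0 < e -> exists N, forall n, (N <= n)%N ->
  fine (P [set w | exists2 s, 0 <= s <= t & L - 2 * n.+1%:R^-1 <= X s w]) <=
  extended_cdf P (hitting_time X L) t + e.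
Proof.
move=> t0 xL cX mX X0 e e0.
have mA := measurable_hitting_time_le L t0 mX cX.
have mE n := measurable_reaches (L - 2 * n.+1%:R^-1) t0 mX cX.
have [N HN] : exists N, forall n, (N <= n)%N ->
    fine (P (~` [set w | (hitting_time X L w <= t%:E)%E])) <=
    fine (P (~` [set w | exists2 s, 0 <= s <= t & L - 2 * n.+1%:R^-1 <= X s w])) + e.
  apply: le_measure_eventually => //; [exact: measurableC|by move=> n; exact: measurableC|].
  apply: filterS X0 => w X0 /= /(hitting_time_le _ _ _ cX) nT.
  have cw r : {within `[0, r], continuous (X^~ w)}.
    by apply: continuous_subspaceW (cX w) => s /=; rewrite !in_itv/= andbT => /andP[].
  have [c] := EVT_max (ltW t0) (cw t); rewrite in_itv/= => /andP[c0 ct] maxc.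
  have XcL : X c w < L.
    rewrite ltNge; apply/negP => LX; apply: nT.
    have [|s] := @IVT _ (X^~ w) 0 c L c0 (cw c).
      by rewrite ge_min le_max X0 (ltW xL) LX orbT.
    rewrite in_itv/= => /andP[s0 sc] XsL; exists s => //.
    by rewrite s0 (le_trans sc).
  have [N hN] := exists_nat_ge (2 / (L - X c w)).
  exists N => n Nn [s st Xs].
  have : X s w <= X c w by apply: maxc; rewrite in_itv.
  apply/negP; rewrite -ltNge (lt_le_trans _ Xs)//.
  rewrite ltrBrDl -ltrBrDr ltr_pdivrMr//.
  have LX0 : 0 < L - X c w by rewrite subr_gt0.
  rewrite mulrC -ltr_pdivrMr// (le_lt_trans hN)// ltr_nat; exact: leq_ltn_trans Nn _.
exists N => n Nn; have := HN n Nn.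
rewrite !fine_probability_setC// /extended_cdf; lra.
Qed.

(* If [X] reaches [L] before [t], its scheme has left [(m + eps, L - eps)] by time
   [t]; it is then either below [m + eps], which the scale function bounds, or above
   [L - eps], an event with the same probability for the scheme of [X'], which in
   turn forces [X'] above [L - 2 eps]. *)
Lemma hitting_cdf_le d (Om : measurableType d) (P : probability Om R) (a : R -> R) X
    d' (Om' : measurableType d') (P' : probability Om' R) (a' : R -> R) X' (m t : R) :
  m < x -> x < L -> 0 < t ->
  {in `]m, L[, a =1 b} -> {in `]m, L[, a' =1 b} ->
  weak_solution_until P a x (hitting_time X L) X ->
  weak_solution_until P' a' x (hitting_time X' L) X' ->
  extended_cdf P (hitting_time X L) t <=
  extended_cdf P' (hitting_time X' L) t + (p L - p x) / (p x - p m).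
Proof.
move=> mx xL t0 ab ab' solX solX'; apply/ler_addgt0Pr => e e0.
(* Five losses: two in fixing [eps] (the level [L - 2 eps] and the lower end [m + eps]), three in
   fixing [n] (the two path comparisons and the exit estimate). *)
have e5 : 0 < e / 5 by rewrite divr_gt0.
have [K K0 bK] := C1_upto_lipschitz m Cb.
have [F [B [fF bB [cX X0] mX HX]]] := weak_solution_euler mx xL K0 t0 bK ab solX.
have [F' [B' [fF' bB' [cX' X0'] mX' HX']]] := weak_solution_euler mx xL K0 t0 bK ab' solX'.
have [N1 HN1] := reaches_cdf_le t0 xL cX' mX' X0' e5.
have pxm : 0 < p x - p m by rewrite subr_gt0 (scale_fun_lt Cb b0)// ltW.
have near0 : \forall eps \near (0 : R)^'+,
    (p L - p x) / (p x - p (m + eps)) <= (p L - p x) / (p x - p m) + e / 5.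
  have cp : p (m + eps) @[eps --> (0 : R)^'+] --> p m.
    have cpm : {for m, continuous p}.
      apply: differentiable_continuous; apply/derivable1_diffP.
      by have := scale_fun_derive Cb b0 (lt_trans mx xL).
    apply: cvg_at_right_filter.
    have : m + eps @[eps --> (0 : R)] --> m.
      by rewrite -[X in _ --> X]addr0; apply: cvgD; [exact: cvg_cst|exact: cvg_id].
    by move=> h; exact: (cvg_comp _ _ h cpm).
  have : (p L - p x) / (p x - p (m + eps)) @[eps --> (0 : R)^'+] --> (p L - p x) / (p x - p m).
    apply: cvgM; first exact: cvg_cst.
    by apply: cvgV; [rewrite gt_eqF|apply: cvgB => //; exact: cvg_cst].
  move=> /cvgrPdist_lt/(_ _ e5); apply: filterS => eps.
  by rewrite distrC ltr_norml => /andP[_ /ltW]; rewrite lerBlDl.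
have near1 : \forall eps \near (0 : R)^'+, m + eps < x /\ x < L - eps.
  have : \forall eps \near (0 : R)^'+, eps < Num.min (x - m) (L - x).
    by apply: nbhs_right_lt; rewrite lt_min !subr_gt0 mx.
  by apply: filterS => eps; rewrite lt_min => /andP[]; split; lra.
have [N2 HN2] : exists N2 : nat, forall n, (N2 <= n)%N ->
   [/\ (p L - p x) / (p x - p (m + n.+1%:R^-1)) <= (p L - p x) / (p x - p m) + e / 5,
     m + n.+1%:R^-1 < x & x < L - n.+1%:R^-1].
  have : \forall eps \near (0 : R)^'+,
      (p L - p x) / (p x - p (m + eps)) <= (p L - p x) / (p x - p m) + e / 5 /\
      (m + eps < x /\ x < L - eps) by exact: filterI near0 near1.
  rewrite /at_right /within/= => /nbhs_ballP[r /= r0 Hr].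
  have [N hN] := exists_nat_ge r^-1.
  exists N => n Nn.
  have [||h1 [h2 h3]] := Hr n.+1%:R^-1; last by split.
    rewrite -ball_normE/= sub0r normrN ger0_norm ?invr_ge0//.
    by rewrite -[ltRHS]invrK ltf_pV2 ?posrE ?invr_gt0// (le_lt_trans hN)// ltr_nat.
  by rewrite invr_gt0.
(* [eps] is fixed before the mesh, since the mesh needed for pathwise closeness depends on it. *)
pose n0 := maxn N1 N2; pose eps : R := n0.+1%:R^-1.
have eps0 : 0 < eps by rewrite invr_gt0.
have h1 := HN1 n0 (leq_maxl _ _).
have [h2 mex xLe] := HN2 n0 (leq_maxr _ _).
rewrite -/eps in h1 h2 mex xLe.
pose hi := L - eps; pose lo := m + eps.
pose S n := brownian_euler B b lo hi (t / n.+1%:R) x n.+1.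
pose S' n := brownian_euler B' b lo hi (t / n.+1%:R) x n.+1.
have cb : {in `]lo, hi[, continuous b}.
  move=> z; rewrite in_itv/= => /andP[_ zL].
  have /continuous_within_itvNycP[cb _] := C1_upto_continuous Cb.
  by apply: cb; rewrite in_itv/= (lt_trans zL)// /hi ltrBlDr ltrDl.
have tn0 n : 0 < t / n.+1%:R by rewrite divr_gt0.
have mS n : measurable_fun setT (S n) by exact: (measurable_brownian_euler fF bB x (tn0 n) cb).
have mS' n : measurable_fun setT (S' n) by exact: (measurable_brownian_euler fF' bB' x (tn0 n) cb).
have mge : measurable (`[hi, +oo[ : set R) by exact: measurable_itv.
have mle : measurable (`]-oo, lo] : set R) by exact: measurable_itv.
have [N3 HN3] : exists N, forall n, (N <= n)%N ->
    extended_cdf P (hitting_time X L) t <=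
    fine (P (S n @^-1` `[hi, +oo[ `|` S n @^-1` `]-oo, lo])) + e / 5.
  apply: le_measure_eventually => //.
  - exact: measurable_hitting_time_le.
  - by move=> n; apply: measurableU; rewrite -[X in measurable X]setTI; exact: mS.
  - apply: filterS (HX eps eps0) => w [N HN] Tt; exists N => n Nn.
    have [/(_ Tt) + _] := HN n Nn; rewrite negb_and -!leNgt => /orP[Slo|hiS].
      by right; rewrite /= in_itv.
    by left; rewrite /= in_itv/= andbT.
(* On complements: a path of [X'] that stays below [L - 2 eps] has a scheme that eventually stays
   below [hi]. *)
have [N4 HN4] : exists N, forall n, (N <= n)%N ->
    fine (P' (~` [set w | exists2 s, 0 <= s <= t & L - 2 * eps <= X' s w])) <=
    fine (P' (~` (S' n @^-1` `[hi, +oo[))) + e / 5.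
  apply: le_measure_eventually => //.
  - by apply: measurableC; exact: measurable_reaches.
  - by move=> n; apply: measurableC; rewrite -[X in measurable X]setTI; exact: mS'.
  - apply: filterS (HX' eps eps0) => w [N HN] nA; exists N => n Nn.
    have [_ H] := HN n Nn; rewrite /= in_itv/= andbT => /H; exact: nA.
have [N5 HN5] := chain_exit_low fF bB t0 eps0 mex xLe e5.
pose n := maxn N3 (maxn N4 N5).
have g3 := HN3 n (leq_maxl _ _).
have g4 := HN4 n (leq_trans (leq_maxl _ _) (leq_maxr _ _)).
have g5 := HN5 n (leq_trans (leq_maxr _ _) (leq_maxr _ _)).
have m1 : measurable (S n @^-1` `[hi, +oo[) by rewrite -[X in measurable X]setTI; exact: mS.
have m2 : measurable (S n @^-1` `]-oo, lo]) by rewrite -[X in measurable X]setTI; exact: mS.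
have m3 : measurable (S' n @^-1` `[hi, +oo[) by rewrite -[X in measurable X]setTI; exact: mS'.
have law : P (S n @^-1` `[hi, +oo[) = P' (S' n @^-1` `[hi, +oo[).
  have mf : measurable_fun setT (fun y : R => (\1_(`[hi, +oo[%classic) y : R)%:E).
    by apply/measurable_EFinP; exact: measurable_indic.
  have f0 y : (0 <= (\1_(`[hi, +oo[%classic) y : R)%:E)%E by rewrite lee_fin.
  have := integral_brownian_euler_eq x n.+1 fF bB fF' bB' (tn0 n) cb mf f0.
  rewrite (_ : (\int[P]_w _)%E = P (S n @^-1` `[hi, +oo[)); last first.
    by rewrite -[X in _ = P X]setIT -integral_indic.
  by rewrite (_ : (\int[P']_w _)%E = P' (S' n @^-1` `[hi, +oo[))// -[X in _ = P' X]setIT -integral_indic.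
have union : fine (P (S n @^-1` `[hi, +oo[ `|` S n @^-1` `]-oo, lo])) <=
    fine (P (S n @^-1` `[hi, +oo[)) + fine (P (S n @^-1` `]-oo, lo])).
  rewrite -fineD ?fin_num_measure// fine_le ?fin_num_measure//; last exact: measureU2.
    exact: measurableU.
  by rewrite fin_numD !fin_num_measure.
rewrite law in union.
rewrite !fine_probability_setC// in g4; last exact: measurable_reaches.
have lowE : [set w | S n w <= lo] = S n @^-1` `]-oo, lo].
  by apply/seteqP; split => w /=; rewrite in_itv.
rewrite -/lo -/hi -/(S n) lowE -/lo in g5.
clear -g3 g4 g5 union h1 h2.
lra.
Qed.

End comparison.

(** * Two-sided bound and the limit in rho *)

Section final.
Context {R : realType}.

Lemma hitting_cdf_lt0 d (Om : measurableType d) (P : probability Om R) X (L t : R) :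
  t < 0 -> extended_cdf P (hitting_time X L) t = 0.
Proof.
move=> t0; rewrite /extended_cdf (_ : [set w | _] = set0) ?measure0//.
apply/seteqP; split => // w /=; apply/negP; rewrite -ltNge (@lt_le_trans _ _ 0%E)//.
by apply: hitting_time_ge => r r0; rewrite ltNge r0.
Qed.

(** Time 0 is treated apart because the mesh [t / (n + 1)] must be positive. *)
Lemma hitting_cdf0 d (Om : measurableType d) (P : probability Om R) X (x L : R) :
  x < L -> continuous_paths X -> measurable_fun setT (X 0) ->
  {ae P, forall w, X 0 w = x} -> extended_cdf P (hitting_time X L) 0 = 0.
Proof.
move=> xL cX mX X0; rewrite /extended_cdf measure_negligible//.
  rewrite (_ : [set w | _] = X 0 @^-1` [set L]).
    by rewrite -[X in measurable X]setTI; exact: (mX measurableT _ (measurable_set1 L)).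
  apply/seteqP; split => w /=.
    by move=> /(hitting_time_le _ _ _ cX)[s]; rewrite -eq_le => /eqP <-.
  by move=> XL; apply/(hitting_time_le _ _ _ cX); exists 0; rewrite ?lexx.
apply: negligibleS X0 => w /= /(hitting_time_le _ _ _ cX)[s]; rewrite -eq_le => /eqP <- XL.
by rewrite XL => Lx; rewrite Lx ltxx in xL.
Qed.

Lemma dist_hitting_cdf_le (b a a' : R -> R) (x L m t : R)
    d (Om : measurableType d) (P : probability Om R) X
    d' (Om' : measurableType d') (P' : probability Om' R) X' :
  C1_upto b L -> lebesgue_measure.-integrable `[L, 0] (EFin \o b) ->
  m < x -> x < L -> 0 <= t ->
  {in `]m, L[, a =1 b} -> {in `]m, L[, a' =1 b} ->
  weak_solution_until P a x (hitting_time X L) X ->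
  weak_solution_until P' a' x (hitting_time X' L) X' ->
  `|extended_cdf P' (hitting_time X' L) t - extended_cdf P (hitting_time X L) t| <=
  (scale_fun b L - scale_fun b x) / (scale_fun b x - scale_fun b m).
Proof.
move=> Cb b0 mx xL t0 ab ab' solX solX'.
have [K K0 bK] := C1_upto_lipschitz m Cb.
have pxL : 0 <= scale_fun b L - scale_fun b x by rewrite subr_ge0 ltW// (scale_fun_lt Cb b0).
have pmx : 0 <= scale_fun b x - scale_fun b m.
  by rewrite subr_ge0 ltW// (scale_fun_lt Cb b0)// ltW.
move: t0; rewrite le_eqVlt => /predU1P[<-|t0].
  have [F [B [_ _ [cX X0] mX _]]] := weak_solution_euler mx xL K0 ltr01 bK ab solX.
  have [F' [B' [_ _ [cX' X0'] mX' _]]] := weak_solution_euler mx xL K0 ltr01 bK ab' solX'.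
  rewrite (hitting_cdf0 xL cX (mX 0 (lexx 0)) X0) (hitting_cdf0 xL cX' (mX' 0 (lexx 0)) X0').
  by rewrite subrr normr0 divr_ge0.
have h1 := hitting_cdf_le Cb b0 mx xL t0 ab ab' solX solX'.
have h2 := hitting_cdf_le Cb b0 mx xL t0 ab' ab solX' solX.
by rewrite ler_norml; apply/andP; split; lra.
Qed.

End final.

Theorem proposition4p1 (R : realType) (b : R -> R) (x L : R)
    (d : measure_display) (Om : measurableType d) (P : probability Om R)
    (X : R -> Om -> R)
    (d' : R -> measure_display) (Om' : forall rho, measurableType (d' rho))
    (P' : forall rho, probability (Om' rho) R)
    (X' : forall rho, R -> Om' rho -> R) :
  x < L ->
  C1_upto b L ->
  (* only a condition when L < 0: beta and p then involve b on [L, 0] *)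
  lebesgue_measure.-integrable `[L, 0] (EFin \o b) ->
  weak_uniqueness b x ->
  weak_solution P b x X ->
  (forall rho : R, 0 < rho -> - rho < L ->
    weak_solution_until (P' rho) (modified_drift b rho) x
      (hitting_time (X' rho) L) (X' rho)) ->
  scale_fun b y @[y --> -oo] --> -oo ->
  cvg_in_distribution P' (fun rho => hitting_time (X' rho) L)
    P (hitting_time X L) /\
  (fun rho => kolmogorov_distance P (hitting_time X L)
                (P' rho) (hitting_time (X' rho) L))
    =O_ (pinfty_nbhs R) (fun rho => - 1 / scale_fun b (- rho)).
Proof.
move=> xL Cb b0 _ solX solX' pNy.
pose p := scale_fun b.
(* The factor 2 pays for replacing [p x - p (- rho)] by [- p (- rho) / 2], valid for large [rho]. *)
pose D := 2 * (p L - p x) + 1.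
have pxL : 0 < p L - p x by rewrite subr_gt0 (scale_fun_lt Cb b0).
have D0 : 0 < D by rewrite /D; lra.
have pNy' A : \forall rho \near +oo, p (- rho) < A.
  have /cvgrNyPlt/(_ A) := pNy.
  move=> [M [Mr HM]]; exists (- M); split; first by rewrite realN.
  by move=> rho Mrho; apply: HM; rewrite ltrNl.
have bound : \forall rho \near +oo, p (- rho) < 0 /\ forall t, 0 <= t ->
    `|extended_cdf (P' rho) (hitting_time (X' rho) L) t -
      extended_cdf P (hitting_time X L) t| <= D / - p (- rho).
  near=> rho.
  have rho0 : 0 < rho by near: rho; apply: nbhs_pinfty_gt; exact: num_real.
  have rhox : - rho < x by rewrite ltrNl; near: rho; apply: nbhs_pinfty_gt; exact: num_real.
  (* This threshold gives both [p (- rho) < 0] and [- p (- rho) / 2 <= p x - p (- rho)]. *)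
  have prho : p (- rho) < - (2 * `|p x|) - 1 by near: rho; exact: pNy'.
  have pa := ler_norm (- p x); rewrite normrN in pa.
  have pa0 := normr_ge0 (p x).
  have prho0 : p (- rho) < 0 by lra.
  split => // t t0.
  have ab : {in `]- rho, L[, modified_drift b rho =1 b}.
    by move=> y; rewrite in_itv/= /modified_drift => /andP[/ltW -> _].
  have sol1 : weak_solution_until P b x (hitting_time X L) X.
    by apply: weak_solution_untilW solX => w /=; rewrite leey.
  have sol2 := solX' rho rho0 (lt_trans rhox xL).
  apply: (le_trans (dist_hitting_cdf_le Cb b0 rhox xL t0 (fun y _ => erefl) ab sol1 sol2)).
  rewrite -/p ler_pdivrMr; last by rewrite subr_gt0 (scale_fun_lt Cb b0)// ltW.
  rewrite mulrAC ler_pdivlMr ?oppr_gt0//.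
  have h1 : - p (- rho) / 2 <= p x - p (- rho) by lra.
  have : D * (- p (- rho) / 2) <= D * (p x - p (- rho)) by rewrite ler_wpM2l// ltW.
  apply: le_trans.
  rewrite [leRHS](_ : _ = D / 2 * - p (- rho)); last by field.
  rewrite ler_wpM2r ?oppr_ge0 ?(ltW prho0)//.
  by rewrite /D; lra.
split.
- move=> t _; have [t0|t0] := leP 0 t; last first.
    rewrite (hitting_cdf_lt0 _ _ _ t0).
    under eq_fun do rewrite (hitting_cdf_lt0 _ _ _ t0).
    exact: cvg_cst.
  apply/cvgrPdist_lt => e e0; near=> rho.
  have [prho0 /(_ t t0) H] : p (- rho) < 0 /\ forall t, 0 <= t ->
    `|extended_cdf (P' rho) (hitting_time (X' rho) L) t -
      extended_cdf P (hitting_time X L) t| <= D / - p (- rho) by near: rho.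
  rewrite distrC (le_lt_trans H)// ltr_pdivrMr ?oppr_gt0// mulrC -ltr_pdivrMr// ltrNr.
  by near: rho; exact: pNy'.
- apply/eqO_exP; exists D => //; near=> rho.
  have [prho0 H] : p (- rho) < 0 /\ forall t, 0 <= t ->
    `|extended_cdf (P' rho) (hitting_time (X' rho) L) t -
      extended_cdf P (hitting_time X L) t| <= D / - p (- rho) by near: rho.
  have ubD : ubound [set `|extended_cdf (P' rho) (hitting_time (X' rho) L) t -
      extended_cdf P (hitting_time X L) t| | t in [set t : R | 0 <= t]] (D / - p (- rho)).
    by move=> _ [t t0 <-]; exact: H.
  (* The real [sup] is meaningful for a nonempty set bounded above: [ubD] gives the bound, time 0 a
     member. *)
  rewrite ger0_norm.
    rewrite -/p normrM normrN1 mul1r normrV ?unitfE ?lt_eqF// ltr0_norm//.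
    by apply: ge_sup => //; exists `|extended_cdf (P' rho) (hitting_time (X' rho) L) 0 -
      extended_cdf P (hitting_time X L) 0|; exists 0 => /=.
  rewrite /kolmogorov_distance (le_trans (normr_ge0 (extended_cdf (P' rho) (hitting_time (X' rho) L) 0 -
      extended_cdf P (hitting_time X L) 0)))//.
  apply: ub_le_sup; first by exists (D / - p (- rho)).
  by exists 0 => /=.
Unshelve. all: by end_near. Qed.
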